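(* Let $k$ be a field, $G=\mathrm{GL}_3\times\mathrm{GL}_3\times\mathrm{GL}_2\times\mathrm{GL}_1$, $W_1=W_2=\mathbb{A}^3$, $V=\wedge^2W_2\oplus W_1\otimes W_2\otimes\mathbb{A}^2$ with the action described in the context, and $U=\{x\in V\mid P_1(x)\neq0,\ P_2(x)\neq0\}$ with $P_1,P_2$ the polynomials defined in the context. Then the map $U_k\ni(x_1,x_2)\mapsto x_2\in\mathbb{A}^3\otimes\mathbb{A}^3\otimes\mathbb{A}^2$ induces a bijection $$G_k\backslash U_k\cong(\mathrm{GL}_3(k)^2\times\mathrm{GL}_2(k))\backslash(\mathbb{A}^3\otimes\mathbb{A}^3\otimes\mathbb{A}^2)^{\mathrm{ss}}_k\cong\mathrm{Ex}_3(k).$$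
   Context: The action: the first $\mathrm{GL}_3$, the second $\mathrm{GL}_3$ and $\mathrm{GL}_2$ act on $W_1$, $W_2$, $\mathbb{A}^2$ respectively by the standard representations, and $t\in\mathrm{GL}_1$ acts on $(x_1,x_2)\in\wedge^2W_2\oplus W_1\otimes W_2\otimes\mathbb{A}^2$ by $(x_1,x_2)\mapsto(tx_1,x_2)$. $\mathrm{Ex}_3(k)$ is the set of conjugacy classes of homomorphisms $\mathrm{Gal}(k^{\mathrm{sep}}/k)\to\mathfrak{S}_3$ (equivalently, $k$-isomorphism classes of splitting fields over $k$ of separable cubic polynomials). $P_1$: regard $x_2\in W_1\otimes W_2\otimes\mathbb{A}^2$ as a pair $(x_{21},x_{22})$ of $3\times3$ matrices, let $F_{x_2}(v)=\det(v_1x_{21}+v_2x_{22})$, a binary cubic form in $v=(v_1,v_2)$; $P_1(x)$ is its discriminant. $(\mathbb{A}^3\otimes\mathbb{A}^3\otimes\mathbb{A}^2)^{\mathrm{ss}}$ is the set where this discriminant is non-zero, and the second bijection associates to the orbit of $x_2$ the field generated over $k$ by the roots of $F_{x_2}(v)$ (the class of the Galois action on the three roots). $P_2$: identify $\wedge^3W_1,\wedge^3W_2,\wedge^2\mathbb{A}^2$ with $\mathbb{A}^1$ by the standard bases. Let $C:(W_1\otimes W_2\otimes\mathbb{A}^2)^{\otimes6}\to W_2^{\otimes3}$ be the linear map with $$C\Bigl(\bigotimes_{i=1}^6(a_i\otimes b_i\otimes c_i)\Bigr)=-(a_1\wedge a_2\wedge a_3)(a_4\wedge a_5\wedge a_6)(c_1\wedge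 c_4)(c_2\wedge c_5)(c_3\wedge c_6)(b_1\wedge b_2\wedge b_4)\,b_3\otimes b_5\otimes b_6,$$ and $\Phi(x_2)=C(x_2^{\otimes6})$. $P_2$ is the polynomial with coefficients in $\mathbb{Z}$ determined by $6P_2(x_1,x_2)=(x_1\otimes x_1\otimes x_1)\wedge\Phi(x_2)$, where $\wedge:\wedge^2W_2\otimes W_2\to\wedge^3W_2\cong\mathbb{A}^1$ is applied in each of the three tensor factors; over $k$ it is obtained by $\mathbb{Z}\to k$. *)

(* Defs.v *)
From HB Require Import structures.
From mathcomp Require Export all_boot all_order all_algebra all_fingroup all_field.
From mathcomp Require Export mpoly.
From mathcomp Require Export boolp classical_sets functions.

Set Implicit Arguments.
Unset Strict Implicit.
Unset Printing Implicit Defensive.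

Import GRing.Theory.
Local Open Scope ring_scope.
Local Open Scope classical_set_scope.

(* [h] factors through the quotient map [q] on [A], and the factor is a
   bijection from [q @` A] onto [B]. *)
Definition induces_bij (T Q1 Q2 : Type) (A : set T) (q : T -> Q1)
    (B : set Q2) (h : T -> Q2) : Prop :=
  exists2 f : Q1 -> Q2, (forall x, A x -> f (q x) = h x) & set_bij (q @` A) B f.

Section Space.
Variable R : comNzRingType.

(* A^3 (x) A^3 (x) A^2: the value at (i, j, l) is the coordinate on
   e_i (x) e_j (x) e_l. *)
Definition tens332 := {ffun 'I_3 * 'I_3 * 'I_2 -> R}.

(* Wedge^2 A^3 is given by coordinates in the basis e_(m+1) /\ e_(m+2), for
   m : 'I_3 with indices mod 3, so that (e_(m+1) /\ e_(m+2)) /\ e_m is the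
   standard generator of Wedge^3 A^3. *)
Definition space := ('cV[R]_3 * tens332)%type.

Definition basis n (i : 'I_n) : 'cV[R]_n := delta_mx i 0.

(* The identification Wedge^n A^n = A^1, on s`_0 /\ ... /\ s`_(n-1). *)
Definition wedge n (s : seq 'cV[R]_n) : R := \det (\matrix_(i, j) s`_j i 0).

Definition wedge2 (u v : 'cV[R]_3) : 'cV[R]_3 :=
  \col_m (u (m + 1) 0 * v (m + 2) 0 - u (m + 2) 0 * v (m + 1) 0).

(* Wedge^2 A^3 (x) A^3 -> Wedge^3 A^3 = A^1 *)
Definition wedge21 (y w : 'cV[R]_3) : R :=
  \sum_(m < 3) y m 0 * wedge [:: basis (m + 1); basis (m + 2); w].

Definition act_wedge2 (g : 'M[R]_3) (y : 'cV[R]_3) : 'cV[R]_3 :=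
  \sum_(m < 3) y m 0 *: wedge2 (g *m basis (m + 1)) (g *m basis (m + 2)).

Definition act_tens (g1 g2 : 'M[R]_3) (g3 : 'M[R]_2) (x : tens332) : tens332 :=
  [ffun p => \sum_(q : 'I_3 * 'I_3 * 'I_2)
     g1 p.1.1 q.1.1 * g2 p.1.2 q.1.2 * g3 p.2 q.2 * x q].

Definition act_space (g1 g2 : 'M[R]_3) (g3 : 'M[R]_2) (t : R) (x : space) :
    space :=
  (t *: act_wedge2 g2 x.1, act_tens g1 g2 g3 x.2).

Definition slice (x : tens332) (l : 'I_2) : 'M[R]_3 :=
  \matrix_(i, j) x (i, j, l).

Definition cubic_form (x : tens332) (v : 'cV[R]_2) : R :=
  \det (v 0 0 *: slice x 0 + v 1 0 *: slice x 1).

(* Indices are shifted by one with respect to the usual notation: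
   a 0, ..., a 5 stand for a_1, ..., a_6. The result is the coordinate of
   C (a_1 (x) b_1 (x) c_1 (x) ... (x) a_6 (x) b_6 (x) c_6) on
   e_(p.1.1) (x) e_(p.1.2) (x) e_(p.2). *)
Definition C_pure (a b : 'I_6 -> 'cV[R]_3) (c : 'I_6 -> 'cV[R]_2)
    (p : 'I_3 * 'I_3 * 'I_3) : R :=
  - (wedge [:: a 0; a 1; a 2] * wedge [:: a 3; a 4; a 5]
     * wedge [:: c 0; c 3] * wedge [:: c 1; c 4] * wedge [:: c 2; c 5]
     * wedge [:: b 0; b 1; b 3]
     * (b 2 p.1.1 0 * b 4 p.1.2 0 * b 5 p.2 0)).

(* C (x^(x)6), by multilinear expansion of x in the standard basis *)
Definition Phi (x : tens332) (p : 'I_3 * 'I_3 * 'I_3) : R :=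
  \sum_(I : {ffun 'I_6 -> 'I_3 * 'I_3 * 'I_2})
    (\prod_s x (I s)) *
    C_pure (fun s => basis (I s).1.1) (fun s => basis (I s).1.2)
           (fun s => basis (I s).2) p.

(* (x_1 (x) x_1 (x) x_1) /\ Phi(x_2) *)
Definition wedge_Phi (x : space) : R :=
  \sum_(p : 'I_3 * 'I_3 * 'I_3)
    wedge21 x.1 (basis p.1.1) * wedge21 x.1 (basis p.1.2)
    * wedge21 x.1 (basis p.2) * Phi x.2 p.

End Space.

Definition map_tens (R S : comNzRingType) (f : R -> S) (x : tens332 R) :
    tens332 S := [ffun p => f (x p)].

(* The coefficient of v_1^(3-i) v_2^i in the binary cubic form of x, read off
   at (v_1, v_2) = (1, 'X). *)
Definition cubic_coef (R : comNzRingType) (x : tens332 R) (i : nat) : R :=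
  (cubic_form (map_tens polyC x) (\col_(l < 2) 'X^l))`_i.

Definition P1 (R : comNzRingType) (x : tens332 R) : R :=
  let a := cubic_coef x 0%N in let b := cubic_coef x 1%N in
  let c := cubic_coef x 2%N in let d := cubic_coef x 3%N in
  b ^+ 2 * c ^+ 2 - 4 * a * c ^+ 3 - 4 * b ^+ 3 * d
  - 27 * a ^+ 2 * d ^+ 2 + 18 * a * b * c * d.

(* Labels of the 21 coordinates on [space]. *)
Notation coord_idx := ('I_3 + 'I_3 * 'I_3 * 'I_2)%type.

Notation zpoly := {mpoly int[#|{: coord_idx}|]}.

Definition generic_point : space zpoly :=
  (\col_m 'X_(enum_rank (inl m : coord_idx)),
   [ffun p => 'X_(enum_rank (inr p : coord_idx))]).

Definition is_P2 (P : zpoly) : Prop := P *+ 6 = wedge_Phi generic_point.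

Definition coord (R : comNzRingType) (x : space R) (c : coord_idx) : R :=
  match c with inl m => x.1 m 0 | inr p => x.2 p end.

Definition zpoly_eval (R : comNzRingType) (P : zpoly) (x : space R) : R :=
  (map_mpoly intr P).@[fun i => coord x (enum_val i)].

Section Orbits.
Variable k : fieldType.

Definition U (P2 : zpoly) : set (space k) :=
  [set x | P1 x.2 != 0 /\ zpoly_eval P2 x != 0].

Definition ss332 : set (tens332 k) := [set x | P1 x != 0].

Definition orbit_space (x : space k) : set (space k) :=
  [set y | exists g1 g2 g3 (t : k),
     [/\ g1 \in unitmx, g2 \in unitmx, g3 \in unitmx, t != 0
       & y = act_space g1 g2 g3 t x]].

Definition orbit_tens (x : tens332 k) : set (tens332 k) :=
  [set y | exists g1 g2 g3,
     [/\ g1 \in unitmx, g2 \in unitmx, g3 \in unitmx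
       & y = act_tens g1 g2 g3 x]].

End Orbits.

Section Galois.
Variables (k K : fieldType) (iota : {rmorphism k -> K}).

Definition separable_closure : Prop :=
  (forall y : K, exists2 p : {poly k},
     separable_poly p & root (map_poly iota p) y) /\
  (forall p : {poly K}, separable_poly p -> size p != 1%N -> exists y, root p y).

Record gal := Gal {
  gal_fun :> {rmorphism K -> K};
  gal_bij : bijective gal_fun;
  gal_fix : forall a, gal_fun (iota a) = iota a }.

Lemma gal_comp_fix (s t : gal) a : (s \o t) (iota a) = iota a.
Proof. by rewrite /= !gal_fix. Qed.

Definition gal_comp (s t : gal) : gal :=
  @Gal (s \o t) (bij_comp (gal_bij s) (gal_bij t)) (gal_comp_fix s t).

(* Homomorphisms Gal(K/k) -> S_3, continuous for the Krull topology. The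
   morphism law is written pointwise because the product of permutations in the
   library composes from left to right. *)
Definition gal_hom : set (gal -> 'S_3) :=
  [set phi : gal -> 'S_3 |
     (forall s t i, phi (gal_comp s t) i = phi s (phi t i)) /\
     (exists X : seq K, forall s : gal,
        (forall y, y \in X -> s y = y) -> phi s = 1%g)].

Definition conj_class (phi : gal -> 'S_3) : set (gal -> 'S_3) :=
  [set psi : gal -> 'S_3 | exists g : 'S_3, forall s, psi s = (phi s ^ g)%g].

Definition Ex3 : set (set (gal -> 'S_3)) := conj_class @` gal_hom.

(* Points of the projective line over K are non-zero vectors up to this
   relation. *)
Definition same_point (v w : 'cV[K]_2) : Prop :=
  exists2 c : K, c != 0 & v = c *: w.

(* r enumerates, without repetition, the zeros in P^1(K) of the binary cubic
   form of x. *)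
Definition root_enum (x : tens332 k) (r : 'I_3 -> 'cV[K]_2) : Prop :=
  [/\ forall i, r i != 0,
      forall i j, same_point (r i) (r j) -> i = j
    & forall v, v != 0 ->
        (cubic_form (map_tens iota x) v = 0 <-> exists i, same_point v (r i))].

(* The actions of Gal(K/k) on the three zeros, for all numberings of them. *)
Definition root_class (x : tens332 k) : set (gal -> 'S_3) :=
  [set phi : gal -> 'S_3 | exists2 r, root_enum x r &
     forall (s : gal) i, same_point (map_mx s (r i)) (r (phi s i))].

End Galois.

Arguments ss332 k : clear implicits.
Arguments Ex3 {k K} iota.
Arguments root_class {k K} iota x _.

(* Main.v *)
(* Let A, B be the two slices of x_2, and let x_1 act on W_2 as a linear form y,
   itself seen as a vector of the dual space. Contracting,
   (x_1 (x) x_1 (x) x_1) /\ Phi(x_2) equals 3 det (T e_0, T e_1, T e_2), where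
   T e = Ay x Be - By x Ae. As T y is twice m = Ay x By, the determinant is divisible
   by 2, which gives P_2 over Z, and det (y, e, f) P_2 = det (m, T e, T f). If P_2(x) is non-zero,
   this identity provides bases of W_1 and W_2 in which x becomes a normal form
   depending only on the cubic form F of x_2; so G-orbits in U with the same x_2
   coincide, and the orbits of semistable x_2 are the classes of binary cubic forms
   with non-zero discriminant under GL_2 and scaling. A semistable x_2 is the second
   component of a point of U: if F has no zero in P^1(k), any non-zero y works, and otherwise a
   zero of F splits off a 1 x 1 block of the pencil.

   Over a separable closure, a cubic form is determined up to a scalar by its three
   zeros in P^1. Two such triples with the same Galois action differ by a
   unique projectivity, which is therefore defined over k. Conversely, given
   phi : Gal -> S_3, Dedekind's independence of characters shows that the vectors l in
   K^3 with s (l i) = l (phi s i) span K^3; two suitable such vectors l, m give the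
   zeros (l (i + 1) - l (i + 2) : m (i + 1) - m (i + 2)). *)

From HB Require Import structures.
From mathcomp Require Import ring.
Require Import Defs.

Set Implicit Arguments.
Unset Strict Implicit.
Unset Printing Implicit Defensive.

Import GRing.Theory.
Local Open Scope ring_scope.
Local Open Scope classical_set_scope.

(** * Vectors in dimension three *)

(** All characteristics and finite fields are allowed, and this shapes the computations. The factor
    2 is removed over Z, before any specialisation: [T] is the polarisation of the quadratic map
    [y |-> Ay x By], and keeping the values of that map on the basis apart from the diagonal [T]
    entries, which are twice those values, leaves an integral formula for half of the determinant.
    Cubic forms are compared through coefficients, since k may have too few points to separate forms
    by their values. On the Galois side the obstacle is scalars: a zero in P^1 is a vector up to a
    factor, so Galois permutes vectors only up to factors. A normalised representative of each zero
    makes the permutation exact. The projectivity between two triples is then scaled by quotients of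
    brackets in which the signs of odd permutations cancel, so its matrix is itself
    Galois-invariant; likewise the product of the three linear forms has invariant coefficients.
    Both descents thus reduce to one fact, that an element of K fixed by all automorphisms lies in
    k, which comes from extending isomorphisms between subfields to K by the lemma of Zorn. *)

Lemma ord3P (P : 'I_3 -> Prop) : P 0 -> P 1 -> P 2 -> forall i, P i.
Proof.
move=> P0 P1 P2 [[|[|[|//]]] lti].
- by rewrite (_ : Ordinal lti = 0) //; apply: val_inj.
- by rewrite (_ : Ordinal lti = 1) //; apply: val_inj.
by rewrite (_ : Ordinal lti = 2) //; apply: val_inj.
Qed.

Lemma ord2P (P : 'I_2 -> Prop) : P 0 -> P 1 -> forall i, P i.
Proof.
move=> P0 P1 [[|[|//]] lti].
- by rewrite (_ : Ordinal lti = 0) //; apply: val_inj.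
by rewrite (_ : Ordinal lti = 1) //; apply: val_inj.
Qed.

Lemma sum3E (V : nmodType) (F : 'I_3 -> V) : \sum_i F i = F 0 + F 1 + F 2.
Proof.
rewrite !big_ord_recl big_ord0 addr0 addrA.
by congr (F _ + F _ + F _); apply: val_inj.
Qed.

Lemma sum2E (V : nmodType) (F : 'I_2 -> V) : \sum_i F i = F 0 + F 1.
Proof.
rewrite !big_ord_recl big_ord0 addr0.
by congr (F _ + F _); apply: val_inj.
Qed.

Lemma ord3_eqs :
  (((1 + 1)%R = 2%R :> 'I_3) * ((1 + 2)%R = 0%R :> 'I_3) *
   ((2 + 1)%R = 0%R :> 'I_3) * ((2 + 2)%R = 1%R :> 'I_3))%type.
Proof. by do !split; apply: val_inj. Qed.

Lemma ord3_lifts :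
  ((lift (0%R : 'I_3) (0%R : 'I_2) = 1%R) * (lift (0%R : 'I_3) (1%R : 'I_2) = 2%R)
   * (lift (1%R : 'I_3) (0%R : 'I_2) = 0%R) * (lift (1%R : 'I_3) (1%R : 'I_2) = 2%R)
   * (lift (2%R : 'I_3) (0%R : 'I_2) = 0%R) * (lift (2%R : 'I_3) (1%R : 'I_2) = 1%R)
   * (lift (0%R : 'I_2) (0%R : 'I_1) = 1%R) * (lift (1%R : 'I_2) (0%R : 'I_1) = 0%R))%type.
Proof. by do !split; apply: val_inj. Qed.

Section Vectors.
Variable R : comNzRingType.
Implicit Types u v w : 'cV[R]_3.

Lemma det3E (A : 'M[R]_3) : \det A =
  A 0 0 * (A 1 1 * A 2 2 - A 2 1 * A 1 2)
  + A 1 0 * (A 2 1 * A 0 2 - A 0 1 * A 2 2)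
  + A 2 0 * (A 0 1 * A 1 2 - A 1 1 * A 0 2).
Proof.
rewrite (expand_det_col _ 0) sum3E /cofactor !(expand_det_row _ 0).
rewrite !sum2E /cofactor !det_mx11 !mxE !ord3_lifts /=.
have m13 : (1 %% 3 = 1)%N by []. have m12 : (1 %% 2 = 1)%N by [].
have m23 : ((1 + 1) %% 3 = 2)%N by [].
rewrite m12 m13 m23 !addn0 !add0n; ring.
Qed.

Lemma wedge3E u v w : wedge [:: u; v; w] =
  u 0 0 * (v 1 0 * w 2 0 - v 2 0 * w 1 0)
  + u 1 0 * (v 2 0 * w 0 0 - v 0 0 * w 2 0)
  + u 2 0 * (v 0 0 * w 1 0 - v 1 0 * w 0 0).
Proof. by rewrite /wedge det3E !mxE /=; ring. Qed.

Lemma wedge2E u v : ((wedge2 u v 0 0 = u 1 0 * v 2 0 - u 2 0 * v 1 0)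
  * (wedge2 u v 1 0 = u 2 0 * v 0 0 - u 0 0 * v 2 0)
  * (wedge2 u v 2 0 = u 0 0 * v 1 0 - u 1 0 * v 0 0))%type.
Proof. by do !split; rewrite mxE ?add0r ?ord3_eqs. Qed.

Lemma det2E (A : 'M[R]_2) : \det A = A 0 0 * A 1 1 - A 0 1 * A 1 0.
Proof.
rewrite (expand_det_row _ 0) sum2E /cofactor !det_mx11 !mxE !ord3_lifts /=.
have m12 : (1 %% 2 = 1)%N by [].
by rewrite m12 !addn0 !add0n; ring.
Qed.

Lemma wedge22E (c d : 'cV[R]_2) : wedge [:: c; d] = c 0 0 * d 1 0 - d 0 0 * c 1 0.
Proof. by rewrite /wedge det2E !mxE. Qed.

Lemma wedge21E u v : wedge21 u v = u 0 0 * v 0 0 + u 1 0 * v 1 0 + u 2 0 * v 2 0.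
Proof.
rewrite /wedge21 sum3E !wedge3E !mxE ?add0r ?ord3_eqs /=; ring.
Qed.

End Vectors.

(** * The polynomial P_2 *)

Section Halfdet.
Variable R : comNzRingType.
Implicit Types u v w y : 'cV[R]_3.

Lemma wedge3Z a u v w : wedge [:: a *: u; v; w] = a * wedge [:: u; v; w].
Proof. by rewrite !wedge3E !mxE; ring. Qed.

(* Half the determinant of \sum_i y_i s_ij (j = 0, 1, 2), where s is symmetric and
   s_ii = 2 n_i. *)
Definition halfdet (n0 n1 n2 s01 s12 s02 : 'cV[R]_3) y : R :=
  let y0 := y 0 0 in let y1 := y 1 0 in let y2 := y 2 0 in
  y0 ^+ 3 * wedge [:: n0; s01; s02] + y1 ^+ 3 * wedge [:: n1; s12; s01]
  + y2 ^+ 3 * wedge [:: n2; s02; s12]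
  + y0 ^+ 2 * y1 * (2 * wedge [:: n0; n1; s02] + wedge [:: n0; s01; s12])
  - y0 ^+ 2 * y2 * (2 * wedge [:: n0; n2; s01] + wedge [:: n0; s02; s12])
  + y1 ^+ 2 * y2 * (2 * wedge [:: n1; n2; s01] + wedge [:: n1; s12; s02])
  - y1 ^+ 2 * y0 * (2 * wedge [:: n1; n0; s12] + wedge [:: n1; s01; s02])
  + y2 ^+ 2 * y0 * (2 * wedge [:: n2; n0; s12] + wedge [:: n2; s02; s01])
  - y2 ^+ 2 * y1 * (2 * wedge [:: n2; n1; s02] + wedge [:: n2; s12; s01])
  + y0 * y1 * y2 * (4 * wedge [:: n0; n1; n2] + wedge [:: s01; s12; s02]).

Lemma halfdetP n0 n1 n2 s01 s12 s02 y :
  let y0 := y 0 0 in let y1 := y 1 0 in let y2 := y 2 0 in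
  let t0 := (2 * y0) *: n0 + y1 *: s01 + y2 *: s02 in
  let t1 := y0 *: s01 + (2 * y1) *: n1 + y2 *: s12 in
  let t2 := y0 *: s02 + y1 *: s12 + (2 * y2) *: n2 in
  2 * halfdet n0 n1 n2 s01 s12 s02 y = wedge [:: t0; t1; t2].
Proof.
by move=> y0 y1 y2 t0 t1 t2; rewrite /halfdet !wedge3E !mxE -/y0 -/y1 -/y2; ring.
Qed.

(** Here [m] is half of [y0 t0 + y1 t1 + y2 t2], so each equation is Cramer's rule for that
    combination with the factor 2 cancelled beforehand. In this form it survives in characteristic
    2. *)
Lemma halfdet_coord n0 n1 n2 s01 s12 s02 y :
  let y0 := y 0 0 in let y1 := y 1 0 in let y2 := y 2 0 in
  let t0 := (2 * y0) *: n0 + y1 *: s01 + y2 *: s02 in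
  let t1 := y0 *: s01 + (2 * y1) *: n1 + y2 *: s12 in
  let t2 := y0 *: s02 + y1 *: s12 + (2 * y2) *: n2 in
  let m := y0 ^+ 2 *: n0 + y1 ^+ 2 *: n1 + y2 ^+ 2 *: n2 + (y0 * y1) *: s01
    + (y1 * y2) *: s12 + (y0 * y2) *: s02 in
  [/\ y0 * halfdet n0 n1 n2 s01 s12 s02 y = wedge [:: m; t1; t2],
      y1 * halfdet n0 n1 n2 s01 s12 s02 y = wedge [:: m; t2; t0] &
      y2 * halfdet n0 n1 n2 s01 s12 s02 y = wedge [:: m; t0; t1] ].
Proof.
move=> y0 y1 y2 t0 t1 t2 m.
by split; rewrite /halfdet !wedge3E !mxE -/y0 -/y1 -/y2; ring.
Qed.

Lemma addvE u v i j : (u + v) i j = u i j + v i j. Proof. by rewrite mxE. Qed.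
Lemma oppvE u i j : (- u) i j = - u i j. Proof. by rewrite mxE. Qed.
Lemma scalevE a u i j : (a *: u) i j = a * u i j. Proof. by rewrite mxE. Qed.
Lemma zerovE i j : (0 : 'cV[R]_3) i j = 0. Proof. by rewrite mxE. Qed.
Definition vecE := (addvE, oppvE, scalevE, zerovE).

Lemma wedge2Dl u u' v : wedge2 (u + u') v = wedge2 u v + wedge2 u' v.
Proof. by apply/colP; elim/ord3P; rewrite vecE !wedge2E !vecE; ring. Qed.
Lemma wedge2Zl a u v : wedge2 (a *: u) v = a *: wedge2 u v.
Proof. by apply/colP; elim/ord3P; rewrite vecE !wedge2E !vecE; ring. Qed.
Lemma wedge2C u v : wedge2 u v = - wedge2 v u.
Proof. by apply/colP; elim/ord3P; rewrite vecE !wedge2E; ring. Qed.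
Lemma wedge2Dr u v v' : wedge2 u (v + v') = wedge2 u v + wedge2 u v'.
Proof. by rewrite wedge2C wedge2Dl opprD -!(wedge2C u). Qed.
Lemma wedge2Zr a u v : wedge2 u (a *: v) = a *: wedge2 u v.
Proof. by rewrite wedge2C wedge2Zl -scalerN -wedge2C. Qed.

(** The polarisation of the quadratic map [y |-> wedge2 (A *m y) (B *m y)]: symmetric in [y] and
    [e], and twice the map when [e = y]. *)
Definition polar (A B : 'M[R]_3) (y e : 'cV[R]_3) : 'cV[R]_3 :=
  wedge2 (A *m y) (B *m e) - wedge2 (B *m y) (A *m e).

Lemma polarD A B y e f : polar A B y (e + f) = polar A B y e + polar A B y f.
Proof. by rewrite /polar !mulmxDr !wedge2Dr opprD addrACA. Qed.

Lemma polarZ A B y a e : polar A B y (a *: e) = a *: polar A B y e.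
Proof. by rewrite /polar -!scalemxAr !wedge2Zr -scalerBr. Qed.

Lemma colvec_sum (y : 'cV[R]_3) :
  y = y 0 0 *: basis R 0 + y 1 0 *: basis R 1 + y 2 0 *: basis R 2.
Proof. by apply/colP; elim/ord3P; rewrite !vecE !mxE /=; ring. Qed.

(** Values of the quadratic map on basis vectors, while [svec] holds those of its polarisation on
    pairs of them; [svec A B i i] would be twice [nvec A B i]. *)
Definition nvec (A B : 'M[R]_3) i := wedge2 (col i A) (col i B).
Definition svec (A B : 'M[R]_3) i j :=
  wedge2 (col i A) (col j B) + wedge2 (col j A) (col i B).

Definition p2 (x : space R) : R :=
  let A := slice x.2 0 in let B := slice x.2 1 in
  halfdet (nvec A B 0) (nvec A B 1) (nvec A B 2)
    (svec A B 0 1) (svec A B 1 2) (svec A B 0 2) x.1.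

Lemma mulmx_colE (A : 'M[R]_3) y :
  A *m y = y 0 0 *: col 0 A + y 1 0 *: col 1 A + y 2 0 *: col 2 A.
Proof.
by rewrite {1}(colvec_sum y) !mulmxDr -!scalemxAr /basis -!colE.
Qed.

Lemma polarE A B y :
  ((polar A B y (basis R 0) = ((2 * y 0 0) *: nvec A B 0 + y 1 0 *: svec A B 0 1 + y 2 0 *: svec A B 0 2)%R)
  * (polar A B y (basis R 1) = (y 0 0 *: svec A B 0 1 + (2 * y 1 0) *: nvec A B 1 + y 2 0 *: svec A B 1 2)%R)
  * (polar A B y (basis R 2) = (y 0 0 *: svec A B 0 2 + y 1 0 *: svec A B 1 2 + (2 * y 2 0) *: nvec A B 2)%R))%type.
Proof.
by do !split; rewrite /polar /nvec /svec /basis -!colE !(mulmx_colE _ y);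
  apply/colP; elim/ord3P; rewrite !(wedge2E, vecE); ring.
Qed.

Lemma wedge2_pencilE A B y : wedge2 (A *m y) (B *m y) =
  y 0 0 ^+ 2 *: nvec A B 0 + y 1 0 ^+ 2 *: nvec A B 1
  + y 2 0 ^+ 2 *: nvec A B 2 + (y 0 0 * y 1 0) *: svec A B 0 1
  + (y 1 0 * y 2 0) *: svec A B 1 2 + (y 0 0 * y 2 0) *: svec A B 0 2.
Proof.
rewrite !(mulmx_colE _ y) /nvec /svec.
by apply/colP; elim/ord3P; rewrite !(wedge2E, vecE); ring.
Qed.

Lemma p2_double x : let T := polar (slice x.2 0) (slice x.2 1) x.1 in
  2 * p2 x = wedge [:: T (basis R 0); T (basis R 1); T (basis R 2)].
Proof. by rewrite /= !polarE /p2 halfdetP. Qed.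

(** The last two entries matter only through [T e /\ T f], which is linear in [e /\ f]. *)
Lemma wedge_polar A B y e f :
  let T := polar A B y in
  let c := wedge2 e f in
  forall m, wedge [:: m; T e; T f] =
    c 0 0 * wedge [:: m; T (basis R 1); T (basis R 2)]
    + c 1 0 * wedge [:: m; T (basis R 2); T (basis R 0)]
    + c 2 0 * wedge [:: m; T (basis R 0); T (basis R 1)].
Proof.
move=> T c m.
have TE g : T g = g 0 0 *: T (basis R 0) + g 1 0 *: T (basis R 1) + g 2 0 *: T (basis R 2).
  by rewrite {1}(colvec_sum g) /T !polarD !polarZ.
rewrite {}/c (TE e) (TE f); move: (T _) (T _) (T _) => t0 t1 t2.
by rewrite !wedge3E !wedge2E !vecE; ring.
Qed.

(** Multiplicativity of the determinant of [T], halved: [halfdet_coord] identifies the three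
    brackets of [wedge_polar] with the coordinates of [x.1] times [p2 x], and contracting [x.1] with
    [e /\ f] gives the bracket on the left. *)
Lemma p2_wedge x e f : let A := slice x.2 0 in let B := slice x.2 1 in
  wedge [:: x.1; e; f] * p2 x =
  wedge [:: wedge2 (A *m x.1) (B *m x.1); polar A B x.1 e; polar A B x.1 f].
Proof.
move=> A B; rewrite wedge_polar !polarE wedge2_pencilE.
have [<- <- <-] := halfdet_coord (nvec A B 0) (nvec A B 1) (nvec A B 2)
  (svec A B 0 1) (svec A B 1 2) (svec A B 0 2) x.1.
by rewrite wedge3E !wedge2E /p2 -/A -/B; ring.
Qed.

(* z l plays the role of the image of x_1 under the slice l; the identity does
   not need that relation. *)
Lemma wedge_Phi_brackets (X : 'I_2 -> 'I_3 -> 'cV[R]_3) (z : 'I_2 -> 'cV[R]_3) :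
  let D := fun a b c : 'cV[R]_3 => wedge [:: a; b; c] in
  let c l0 l1 l2 (p q r : 'I_3) : R :=
     D (X l0 p) (X l1 q) (z l2) * D (X (1 - l0) r) (z (1 - l1)) (z (1 - l2)) in
  \sum_(l0 < 2) \sum_(l1 < 2) \sum_(l2 < 2) (-1) ^+ (l0 + l1 + l2) *
    (c l0 l1 l2 0 1 2 + c l0 l1 l2 1 2 0 + c l0 l1 l2 2 0 1
     - c l0 l1 l2 1 0 2 - c l0 l1 l2 0 2 1 - c l0 l1 l2 2 1 0) =
  - (3 * D (wedge2 (z 0) (X 1 0) - wedge2 (z 1) (X 0 0))
           (wedge2 (z 0) (X 1 1) - wedge2 (z 1) (X 0 1))
           (wedge2 (z 0) (X 1 2) - wedge2 (z 1) (X 0 2))).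
Proof.
move=> D c; rewrite /c !sum2E (subr0 (1 : 'I_2)) (subrr (1 : 'I_2)) /=.
have m12 : (1 %% 2 = 1)%N by [].
rewrite !m12 /D !wedge3E !(wedge2E, vecE).
ring.
Qed.

End Halfdet.

(** * Expansion of the contraction defining P_2 *)

Section FfunSums.

Definition fcons (T : Type) n (q : T) (J : {ffun 'I_n -> T}) : {ffun 'I_n.+1 -> T} :=
  [ffun s => if unlift ord0 s is Some j then J j else q].

Lemma fcons0 (T : Type) n (q : T) (J : {ffun 'I_n -> T}) : fcons q J ord0 = q.
Proof. by rewrite ffunE unlift_none. Qed.

Lemma fconsS (T : Type) n (q : T) (J : {ffun 'I_n -> T}) j :
  fcons q J (lift ord0 j) = J j.
Proof. by rewrite ffunE liftK. Qed.

Lemma sum_ffunS (V : nmodType) (T : finType) n (G : {ffun 'I_n.+1 -> T} -> V) :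
  \sum_I G I = \sum_q \sum_(J : {ffun 'I_n -> T}) G (fcons q J).
Proof.
rewrite pair_bigA /=.
rewrite (reindex (fun p : T * {ffun 'I_n -> T} => fcons p.1 p.2)) //=.
exists (fun I : {ffun 'I_n.+1 -> T} => (I ord0, [ffun j => I (lift ord0 j)])).
  move=> [q J] _ /=; rewrite fcons0; congr (_, _).
  by apply/ffunP => j; rewrite ffunE fconsS.
move=> I _ /=; apply/ffunP => s; rewrite ffunE.
by case: unliftP => [j ->|->]; rewrite ?ffunE.
Qed.

Lemma sum_ffun0 (V : nmodType) (T : finType) (G : {ffun 'I_0 -> T} -> V) J :
  \sum_I G I = G J.
Proof.
rewrite (big_pred1 J) // => I; apply/esym/eqP/ffunP; by case.
Qed.

Lemma sum_ffun6 (V : nmodType) (T : finType) (G : T -> T -> T -> T -> T -> T -> V) :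
  \sum_(I : {ffun 'I_6 -> T}) G (I 0) (I 1) (I 2) (I 3) (I 4) (I 5) =
  \sum_q0 \sum_q1 \sum_q2 \sum_q3 \sum_q4 \sum_q5 G q0 q1 q2 q3 q4 q5.
Proof.
rewrite sum_ffunS; apply: eq_bigr => q0 _.
rewrite sum_ffunS; apply: eq_bigr => q1 _.
rewrite sum_ffunS; apply: eq_bigr => q2 _.
rewrite sum_ffunS; apply: eq_bigr => q3 _.
rewrite sum_ffunS; apply: eq_bigr => q4 _.
rewrite sum_ffunS; apply: eq_bigr => q5 _.
rewrite (sum_ffun0 _ [ffun=> q0]).
pose l n : 'I_n -> 'I_n.+1 := lift ord0.
congr (G _ _ _ _ _ _).
- by rewrite (_ : 0 = ord0) ?fcons0 //; apply: val_inj.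
- by rewrite (_ : 1 = l _ ord0) ?fconsS ?fcons0 //; apply: val_inj.
- by rewrite (_ : 2 = l _ (l _ ord0)) ?fconsS ?fcons0 //; apply: val_inj.
- by rewrite (_ : 3 = l _ (l _ (l _ ord0))) ?fconsS ?fcons0 //; apply: val_inj.
- by rewrite (_ : 4 = l _ (l _ (l _ (l _ ord0)))) ?fconsS ?fcons0 //; apply: val_inj.
by rewrite (_ : 5 = l _ (l _ (l _ (l _ (l _ ord0))))) ?fconsS ?fcons0 //; apply: val_inj.
Qed.

Lemma prod6E (R : comNzRingType) (F : 'I_6 -> R) :
  \prod_s F s = F 0 * F 1 * F 2 * F 3 * F 4 * F 5.
Proof.
rewrite !big_ord_recl big_ord0 mulr1 !mulrA.
by congr (F _ * F _ * F _ * F _ * F _ * F _); apply: val_inj.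
Qed.

Lemma sum_ffun3 (V : nmodType) (T1 T2 T3 S : finType)
    (G : {ffun S -> T1 * T2 * T3} -> V) :
  \sum_I G I = \sum_(L : {ffun S -> T3}) \sum_(J : {ffun S -> T2})
    \sum_(A : {ffun S -> T1}) G [ffun s => (A s, J s, L s)].
Proof.
rewrite pair_bigA pair_bigA /=.
rewrite (reindex (fun p : {ffun S -> T3} * {ffun S -> T2} * {ffun S -> T1} =>
   [ffun s => (p.2 s, p.1.2 s, p.1.1 s)])) //=.
exists (fun I : {ffun S -> T1 * T2 * T3} =>
   ([ffun s => (I s).2], [ffun s => (I s).1.2], [ffun s => (I s).1.1])).
  by move=> [[L J] A] _ /=; do 2?congr (_, _); apply/ffunP => j; rewrite !ffunE.
by move=> I _ /=; apply/ffunP => s; rewrite !ffunE; case: (I s) => [[]].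
Qed.

End FfunSums.

Section PhiExpansion.
Variable R : comNzRingType.

Lemma wedge3_sum (u v w : 'cV[R]_3) :
  \sum_i \sum_j \sum_k u i 0 * v j 0 * w k 0 *
     wedge [:: basis R i; basis R j; basis R k] = wedge [:: u; v; w].
Proof.
rewrite !sum3E !wedge3E !mxE /=.
ring.
Qed.

Lemma alt3_sum (f : 'I_3 -> 'I_3 -> 'I_3 -> R) :
  \sum_i \sum_j \sum_k wedge [:: basis R i; basis R j; basis R k] * f i j k =
  f 0 1 2 + f 1 2 0 + f 2 0 1 - f 1 0 2 - f 0 2 1 - f 2 1 0.
Proof.
rewrite !sum3E !wedge3E !mxE /=.
ring.
Qed.

Lemma wedge21_basis (y : 'cV[R]_3) j : wedge21 y (basis R j) = y j 0.
Proof.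
by elim/ord3P: j; rewrite wedge21E !mxE /=; ring.
Qed.

Lemma sum_basis n (y : 'I_n -> R) i : \sum_p y p * basis R i p 0 = y i.
Proof.
rewrite (bigD1 i) //= mxE !eqxx mulr1 big1 ?addr0 // => p /negPf ne.
by rewrite mxE ne mulr0.
Qed.

Lemma sum_triple (T1 T2 T3 : finType) (f : T1 -> R) (g : T2 -> R) (h : T3 -> R) :
  \sum_(p : T1 * T2 * T3) f p.1.1 * g p.1.2 * h p.2 =
  (\sum_i f i) * (\sum_j g j) * (\sum_k h k).
Proof.
rewrite -(pair_bigA _ (fun p k => f p.1 * g p.2 * h k)) /=.
under eq_bigr => p _ do rewrite -big_distrr /=.
rewrite -big_distrl -(pair_bigA _ (fun i j => f i * g j)) /=; congr (_ * _).
by under eq_bigr => i _ do rewrite -big_distrr /=; rewrite -big_distrl.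
Qed.

Let W (i j k : 'I_3) : R := wedge [:: basis R i; basis R j; basis R k].
Let w (i j : 'I_2) : R := wedge [:: basis R i; basis R j].

(** Contracting the three output slots with [x_1] replaces the basis vectors there by coordinates of
    [x_1]. The remaining sum is split by tensor factor, so that each factor can be summed out on its
    own. *)
Lemma wedge_Phi_sum (x : space R) : wedge_Phi x =
  - \sum_(L : {ffun 'I_6 -> 'I_2}) \sum_(J : {ffun 'I_6 -> 'I_3})
    \sum_(A : {ffun 'I_6 -> 'I_3}) (\prod_s x.2 (A s, J s, L s)) *
      (W (A 0) (A 1) (A 2) * W (A 3) (A 4) (A 5)
       * (w (L 0) (L 3) * w (L 1) (L 4) * w (L 2) (L 5)
       * (W (J 0) (J 1) (J 3) * (x.1 (J 2) 0 * x.1 (J 4) 0 * x.1 (J 5) 0)))).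
Proof.
rewrite /wedge_Phi /Phi.
under eq_bigr => p _ do rewrite !wedge21_basis big_distrr /=.
rewrite exchange_big /= sum_ffun3 -sumrN; apply: eq_bigr => L _ /=.
rewrite -sumrN; apply: eq_bigr => J _ /=; rewrite -sumrN; apply: eq_bigr => A _ /=.
rewrite /C_pure !ffunE /=; set P := \prod_s _.
have -> : \prod_s x.2 (A s, J s, L s) = P.
  by apply: eq_bigr => s _; rewrite ffunE.
pose f i p := x.1 p 0 * basis R i p 0.
have e i : \sum_p f i p = x.1 i 0 by rewrite sum_basis.
have key (a b c d d' g : R) : \sum_(p : 'I_3 * 'I_3 * 'I_3)
    x.1 p.1.1 0 * x.1 p.1.2 0 * x.1 p.2 0 * (P * - (a * b * c * d * d' * g *
     (basis R (J 2) p.1.1 0 * basis R (J 4) p.1.2 0 * basis R (J 5) p.2 0))) =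
   - (P * (a * b * (c * d * d' * (g * (x.1 (J 2) 0 * x.1 (J 4) 0 * x.1 (J 5) 0))))).
  transitivity (\sum_(p : 'I_3 * 'I_3 * 'I_3)
     - (P * (a * b * (c * d * d' * g))) * (f (J 2) p.1.1 * f (J 4) p.1.2 * f (J 5) p.2)).
    by apply: eq_bigr => p _; rewrite /f; ring.
  by rewrite -big_distrr (sum_triple (f _)) !e /=; ring.
exact: key.
Qed.

(** The first tensor factors meet only the two determinants in the [a_s]; multilinearity turns the
    sum into determinants of columns of slices. *)
Lemma sum_A (x : tens332 R) (J : {ffun 'I_6 -> 'I_3}) (L : {ffun 'I_6 -> 'I_2}) :
  let X s := col (J s) (slice x (L s)) in
  \sum_(A : {ffun 'I_6 -> 'I_3}) (\prod_s x (A s, J s, L s)) *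
      (W (A 0) (A 1) (A 2) * W (A 3) (A 4) (A 5)) =
  wedge [:: X 0; X 1; X 2] * wedge [:: X 3; X 4; X 5].
Proof.
move=> X; rewrite -!wedge3_sum.
pose xx s a := x (a, J s, L s).
under eq_bigr => A _ do rewrite prod6E.
rewrite (sum_ffun6 (fun a0 a1 a2 a3 a4 a5 => xx 0 a0 * xx 1 a1 * xx 2 a2 *
  xx 3 a3 * xx 4 a4 * xx 5 a5 * (W a0 a1 a2 * W a3 a4 a5))).
do 3!(rewrite big_distrl; apply: eq_bigr => ? _ /=).
do 3!(rewrite big_distrr; apply: eq_bigr => ? _ /=).
by rewrite !mxE /xx /W; ring.
Qed.

(** The indices [J 2], [J 4], [J 5] are weighted by coordinates of [x_1] and turn columns into the
    vectors [z]; [J 0], [J 1], [J 3] stay under the alternating symbol [W]. *)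
Lemma sum_J (x : space R) (L : {ffun 'I_6 -> 'I_2}) :
  let X j s := col j (slice x.2 (L s)) in
  let z s := slice x.2 (L s) *m x.1 in
  \sum_(J : {ffun 'I_6 -> 'I_3})
      wedge [:: X (J 0) 0; X (J 1) 1; X (J 2) 2] * wedge [:: X (J 3) 3; X (J 4) 4; X (J 5) 5]
      * (W (J 0) (J 1) (J 3) * (x.1 (J 2) 0 * x.1 (J 4) 0 * x.1 (J 5) 0)) =
  \sum_i \sum_j \sum_k W i j k * (
     wedge [:: X i 0; X j 1; z 2] * wedge [:: X k 3; z 4; z 5]).
Proof.
move=> X z.
rewrite (sum_ffun6 (fun j0 j1 j2 j3 j4 j5 =>
      wedge [:: X j0 0; X j1 1; X j2 2] * wedge [:: X j3 3; X j4 4; X j5 5]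
      * (W j0 j1 j3 * (x.1 j2 0 * x.1 j4 0 * x.1 j5 0)))).
apply: eq_bigr => j0 _; apply: eq_bigr => j1 _.
rewrite exchange_big; apply: eq_bigr => j3 _ /=.
have zE s : z s = x.1 0 0 *: X 0 s + x.1 1 0 *: X 1 s + x.1 2 0 *: X 2 s.
  by rewrite /z mulmx_colE.
have -> : wedge [:: X j0 0; X j1 1; z 2] =
    \sum_j2 x.1 j2 0 * wedge [:: X j0 0; X j1 1; X j2 2].
  by rewrite sum3E zE !wedge3E !vecE; ring.
have -> : wedge [:: X j3 3; z 4; z 5] =
    \sum_j4 \sum_j5 x.1 j4 0 * x.1 j5 0 * wedge [:: X j3 3; X j4 4; X j5 5].
  by rewrite !sum3E !zE !wedge3E !vecE; ring.
have key (a b : 'I_3 -> R) (c : 'I_3 -> 'I_3 -> R) (d : R) :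
    \sum_j2 \sum_j4 \sum_j5 a j2 * c j4 j5 * (d * (b j2 * b j4 * b j5)) =
    d * ((\sum_j2 b j2 * a j2) * (\sum_j4 \sum_j5 b j4 * b j5 * c j4 j5)).
  rewrite big_distrl big_distrr; apply: eq_bigr => j2 _ /=.
  rewrite !big_distrr; apply: eq_bigr => j4 _ /=.
  by rewrite !big_distrr; apply: eq_bigr => j5 _ /=; ring.
exact: key.
Qed.

(** On basis vectors of the plane, [w l m] vanishes unless [m] is the other index [1 - l], and is
    then the sign [(-1) ^+ l]. *)
Lemma wedge2_sum3 (g : 'I_2 -> 'I_2 -> 'I_2 -> 'I_2 -> 'I_2 -> 'I_2 -> R) :
  \sum_l0 \sum_l1 \sum_l2 \sum_l3 \sum_l4 \sum_l5
    w l0 l3 * w l1 l4 * w l2 l5 * g l0 l1 l2 l3 l4 l5 =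
  \sum_(l0 < 2) \sum_(l1 < 2) \sum_(l2 < 2) (-1) ^+ (l0 + l1 + l2) *
    g l0 l1 l2 (1 - l0) (1 - l1) (1 - l2).
Proof.
have E (h : 'I_2 -> 'I_2 -> R) l : \sum_m w l m * h l m = (-1) ^+ l * h l (1 - l).
  elim/ord2P: l; rewrite sum2E /w !wedge22E !mxE /= ?(subr0 (1 : 'I_2)) ?(subrr (1 : 'I_2)).
    by rewrite expr0; ring.
  have m12 : (1 %% 2 = 1)%N by [].
  by rewrite m12 expr1; ring.
apply: eq_bigr => l0 _; apply: eq_bigr => l1 _; apply: eq_bigr => l2 _.
have F (a b c : 'I_2 -> R) (h : 'I_2 -> 'I_2 -> 'I_2 -> R) :
    \sum_l3 \sum_l4 \sum_l5 a l3 * b l4 * c l5 * h l3 l4 l5 =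
    \sum_l3 a l3 * (\sum_l4 b l4 * (\sum_l5 c l5 * h l3 l4 l5)).
  apply: eq_bigr => l3 _; rewrite big_distrr; apply: eq_bigr => l4 _ /=.
  by rewrite !big_distrr; apply: eq_bigr => l5 _ /=; ring.
rewrite F.
under eq_bigr => l3 _.
  under eq_bigr => l4 _ do rewrite (E (fun l2 l5 => g l0 l1 l2 l3 l4 l5)).
  rewrite (E (fun l1 l4 => (-1) ^+ l2 * g l0 l1 l2 l3 l4 (1 - l2))).
  over.
rewrite (E (fun l0 l3 => (-1) ^+ l1 * ((-1) ^+ l2 * g l0 l1 l2 l3 (1 - l1) (1 - l2)))).
by rewrite !exprD !mulrA.
Qed.

Lemma wedge_Phi_p2 (x : space R) : wedge_Phi x = 6 * p2 x.
Proof.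
pose X l i := col i (slice x.2 l).
pose z l := slice x.2 l *m x.1.
pose g l0 l1 l2 l3 l4 l5 := \sum_i \sum_j \sum_k W i j k *
  (wedge [:: X l0 i; X l1 j; z l2] * wedge [:: X l3 k; z l4; z l5]).
rewrite wedge_Phi_sum.
have -> : \sum_(L : {ffun 'I_6 -> 'I_2}) \sum_(J : {ffun 'I_6 -> 'I_3})
    \sum_(A : {ffun 'I_6 -> 'I_3}) (\prod_s x.2 (A s, J s, L s)) *
      (W (A 0) (A 1) (A 2) * W (A 3) (A 4) (A 5)
       * (w (L 0) (L 3) * w (L 1) (L 4) * w (L 2) (L 5)
       * (W (J 0) (J 1) (J 3) * (x.1 (J 2) 0 * x.1 (J 4) 0 * x.1 (J 5) 0)))) =
   \sum_(L : {ffun 'I_6 -> 'I_2}) w (L 0) (L 3) * w (L 1) (L 4) * w (L 2) (L 5) *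
     g (L 0) (L 1) (L 2) (L 3) (L 4) (L 5).
  apply: eq_bigr => L _; have sJ := sum_J x L; rewrite /= in sJ.
  rewrite /g /X /z -sJ.
  have distl (S : finType) (F G : S -> R) c :
      \sum_A F A * (G A * c) = (\sum_A F A * G A) * c.
    by rewrite big_distrl; apply: eq_bigr => A _; rewrite mulrA.
  have distr (S : finType) (F G : S -> R) c :
      \sum_A F A * (c * G A) = c * (\sum_A F A * G A).
    by rewrite big_distrr; apply: eq_bigr => A _; rewrite mulrCA.
  etransitivity; last exact: distr.
  apply: eq_bigr => J _ /=.
  by etransitivity; [exact: distl | rewrite sum_A].
rewrite (sum_ffun6 (fun l0 l1 l2 l3 l4 l5 =>
  w l0 l3 * w l1 l4 * w l2 l5 * g l0 l1 l2 l3 l4 l5)) wedge2_sum3.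
under eq_bigr => l0 _.
  under eq_bigr => l1 _.
    under eq_bigr => l2 _ do rewrite /g alt3_sum.
    over.
  over.
(* The sign in the definition of [C_pure] cancels the one produced by the bracket identity. The 6 is
   the 3 of that identity times the 2 of [p2_double]. *)
rewrite wedge_Phi_brackets opprK.
rewrite (_ : 6 * p2 x = 3 * (2 * p2 x)); last by ring.
by rewrite p2_double /polar /X /z /basis -!colE.
Qed.

End PhiExpansion.

(** * Base change, and P_2 as a polynomial over Z *)

Section MapP2.
Variables (R S : comNzRingType) (f : {rmorphism R -> S}).

Lemma map_wedge2 u v : map_mx f (wedge2 u v) = wedge2 (map_mx f u) (map_mx f v).
Proof. by apply/colP => i; rewrite !mxE rmorphB !rmorphM. Qed.

Lemma map_wedge3 (u v w : 'cV[R]_3) :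
  f (wedge [:: u; v; w]) = wedge [:: map_mx f u; map_mx f v; map_mx f w].
Proof. by rewrite !wedge3E !(rmorphB, rmorphD, rmorphM) !mxE. Qed.

Lemma map_slice x l : slice (map_tens f x) l = map_mx f (slice x l).
Proof. by apply/matrixP => i j; rewrite !mxE ffunE. Qed.

Lemma map_nvec A B i : map_mx f (nvec A B i) = nvec (map_mx f A) (map_mx f B) i.
Proof. by rewrite /nvec map_wedge2 !map_col. Qed.

Lemma map_svec A B i j :
  map_mx f (svec A B i j) = svec (map_mx f A) (map_mx f B) i j.
Proof. by rewrite /svec map_mxD !map_wedge2 !map_col. Qed.

Lemma map_p2 (x : space R) : p2 (map_mx f x.1, map_tens f x.2) = f (p2 x).
Proof.
rewrite /p2 /= !map_slice -!map_nvec -!map_svec /halfdet.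
rewrite ![map_mx f x.1 _ _]mxE -!map_wedge3.
do !move: (wedge [:: _; _; _]) => ?.
move: (x.1 0 0) (x.1 1 0) (x.1 2 0) => ? ? ?.
by rewrite !(rmorphXn, rmorph_nat, rmorphB, rmorphD, rmorphM).
Qed.
End MapP2.

Definition P2_poly : zpoly := p2 generic_point.

Lemma P2_polyP : is_P2 P2_poly.
Proof. by rewrite /is_P2 wedge_Phi_p2 mulr_natl. Qed.

(** [p2] commutes with ring morphisms, and evaluation at [x] is a morphism that carries the generic
    point to [x]. *)
Lemma zpoly_eval_P2 (R : comNzRingType) (x : space R) : zpoly_eval P2_poly x = p2 x.
Proof.
pose v (i : 'I_#|{: 'I_3 + 'I_3 * 'I_3 * 'I_2}|) := coord x (enum_val i).
pose h : {rmorphism zpoly -> R} := meval v \o map_mpoly intr.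
rewrite /zpoly_eval -/v (_ : _.@[v] = h P2_poly) // -map_p2; congr p2.
have hX c : h 'X_(enum_rank c) = coord x c.
  by rewrite /h /= map_mpolyX mevalXU /v enum_rankK.
case: x @v h hX => x1 x2 v h hX; congr (_, _).
  by apply/colP => i; rewrite !mxE hX.
by apply/ffunP => p; rewrite !ffunE hX.
Qed.

(** * Binary cubic forms *)

Section Forms.
Variable R : comNzRingType.
Implicit Types (x : tens332 R) (v : 'cV[R]_2).

Definition binary_cubic (c : nat -> R) v :=
  c 0%N * v 0 0 ^+ 3 + c 1%N * v 0 0 ^+ 2 * v 1 0 + c 2%N * v 0 0 * v 1 0 ^+ 2
  + c 3%N * v 1 0 ^+ 3.

(** The expansion of the determinant by columns, free of polynomials, so that morphisms and [ring]
    apply directly. The last branch answers for every index from 3 on, hence the bounds [i < 4]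
    below. *)
Definition det_coef x (n : nat) : R :=
  let a i := col i (slice x 0) in let b i := col i (slice x 1) in
  match n with
  | 0 => wedge [:: a 0; a 1; a 2]
  | 1 => wedge [:: b 0; a 1; a 2] + wedge [:: a 0; b 1; a 2] + wedge [:: a 0; a 1; b 2]
  | 2 => wedge [:: a 0; b 1; b 2] + wedge [:: b 0; a 1; b 2] + wedge [:: b 0; b 1; a 2]
  | _ => wedge [:: b 0; b 1; b 2]
  end.

Lemma det_cols (A : 'M[R]_3) : \det A = wedge [:: col 0 A; col 1 A; col 2 A].
Proof. by rewrite wedge3E !mxE det3E. Qed.

Lemma cubic_form_det_coef x v : cubic_form x v = binary_cubic (det_coef x) v.
Proof.
rewrite /cubic_form det_cols !linearD !linearZ /= /binary_cubic /det_coef.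
by rewrite !wedge3E !vecE; ring.
Qed.

End Forms.

Lemma map_det_coef (R S : comNzRingType) (f : {rmorphism R -> S}) x n :
  det_coef (map_tens f x) n = f (det_coef x n).
Proof.
rewrite /det_coef !map_slice -!map_col -!map_wedge3.
by case: n => [|[|[|n]]]; rewrite ?rmorphD.
Qed.

Section Coefs.
Variable R : comNzRingType.
Implicit Types (x : tens332 R) (v : 'cV[R]_2).

Lemma binary_cubic_coef (c : nat -> R) i : (i < 4)%N ->
  (binary_cubic (fun n => (c n)%:P) (\col_(l < 2) 'X^l))`_i = c i.
Proof.
rewrite /binary_cubic !mxE expr0 expr1 !expr1n !mulr1.
rewrite !(coefD, coefCM, coefMX, coefX, coefXn, coefC).
by case: i => [|[|[|[|//]]]] _ /=; rewrite !(mulr0, mulr1, add0r, addr0).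
Qed.

Lemma cubic_coefE x i : (i < 4)%N -> cubic_coef x i = det_coef x i.
Proof.
move=> lti; rewrite /cubic_coef cubic_form_det_coef -[RHS]binary_cubic_coef //.
by rewrite /binary_cubic !map_det_coef.
Qed.

Lemma cubic_formE x v : cubic_form x v = binary_cubic (cubic_coef x) v.
Proof. by rewrite cubic_form_det_coef /binary_cubic !cubic_coefE. Qed.

Definition cubic_disc (c : nat -> R) : R :=
  c 1%N ^+ 2 * c 2%N ^+ 2 - 4 * c 0%N * c 2%N ^+ 3 - 4 * c 1%N ^+ 3 * c 3%N
  - 27 * c 0%N ^+ 2 * c 3%N ^+ 2 + 18 * c 0%N * c 1%N * c 2%N * c 3%N.

Lemma P1E x : P1 x = cubic_disc (cubic_coef x). Proof. by []. Qed.

(* The coefficients of v |-> binary_cubic c (g^T v). *)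
Definition cubic_subst (g : 'M[R]_2) (c : nat -> R) (n : nat) : R :=
  let p := g 0 0 in let q := g 0 1 in let r := g 1 0 in let s := g 1 1 in
  match n with
  | 0 => c 0%N * p ^+ 3 + c 1%N * p ^+ 2 * q + c 2%N * p * q ^+ 2 + c 3%N * q ^+ 3
  | 1 => 3 * c 0%N * p ^+ 2 * r + c 1%N * (p ^+ 2 * s + 2 * p * r * q)
         + c 2%N * (2 * p * q * s + r * q ^+ 2) + 3 * c 3%N * q ^+ 2 * s
  | 2 => 3 * c 0%N * p * r ^+ 2 + c 1%N * (2 * p * r * s + r ^+ 2 * q)
         + c 2%N * (p * s ^+ 2 + 2 * r * q * s) + 3 * c 3%N * q * s ^+ 2
  | _ => c 0%N * r ^+ 3 + c 1%N * r ^+ 2 * s + c 2%N * r * s ^+ 2 + c 3%N * s ^+ 3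
  end.

Lemma trmul2E (g : 'M[R]_2) v :
  (((g^T *m v) 0 0 = (g 0%R 0%R * v 0%R 0%R + g 1%R 0%R * v 1%R 0%R)%R) *
   ((g^T *m v) 1 0 = (g 0%R 1%R * v 0%R 0%R + g 1%R 1%R * v 1%R 0%R)%R))%type.
Proof. by rewrite !mxE !sum2E !mxE. Qed.

Lemma binary_cubic_subst g c v :
  binary_cubic c (g^T *m v) = binary_cubic (cubic_subst g c) v.
Proof. by rewrite /binary_cubic /cubic_subst !trmul2E; ring. Qed.

Lemma cubic_disc_subst g c : cubic_disc (cubic_subst g c) = \det g ^+ 6 * cubic_disc c.
Proof. by rewrite /cubic_disc /cubic_subst det2E; ring. Qed.

Lemma eq_cubic_disc c c' :
  (forall i, (i < 4)%N -> c i = c' i) -> cubic_disc c = cubic_disc c'.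
Proof. by move=> e; rewrite /cubic_disc !e. Qed.

Lemma cubic_disc_scale k c : cubic_disc (fun n => k * c n) = k ^+ 4 * cubic_disc c.
Proof. by rewrite /cubic_disc; ring. Qed.

Lemma slice_act (g1 g2 : 'M[R]_3) (g3 : 'M[R]_2) x l :
  slice (act_tens g1 g2 g3 x) l = g1 *m (\sum_l' g3 l l' *: slice x l') *m g2^T.
Proof.
apply/matrixP => i j; rewrite !mxE ffunE.
transitivity (\sum_a \sum_b \sum_l' g1 i a * g2 j b * g3 l l' * x (a, b, l')).
  rewrite (pair_bigA _ (fun a b => \sum_l' g1 i a * g2 j b * g3 l l' * x (a, b, l'))).
  rewrite (pair_bigA _ (fun p l' => g1 i p.1 * g2 j p.2 * g3 l l' * x (p.1, p.2, l'))).
  by apply: eq_bigr => [[[a b] l']] _.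
rewrite exchange_big; apply: eq_bigr => b _ /=; rewrite !mxE big_distrl /=.
apply: eq_bigr => a _; rewrite summxE big_distrr big_distrl /=.
apply: eq_bigr => l' _; rewrite !mxE; ring.
Qed.

Lemma slice_inj x y : (forall l, slice x l = slice y l) -> x = y.
Proof.
move=> e; apply/ffunP => [[[i j] l]].
by move/matrixP: (e l) => /(_ i j); rewrite !mxE.
Qed.

Lemma cubic_form_act (g1 g2 : 'M[R]_3) (g3 : 'M[R]_2) x v :
  cubic_form (act_tens g1 g2 g3 x) v =
  \det g1 * \det g2 * cubic_form x (g3^T *m v).
Proof.
rewrite /cubic_form !slice_act !sum2E !trmul2E.
rewrite -(det_tr g2) mulrAC -!det_mulmx; congr (\det _).
rewrite !(mulmxDr, mulmxDl) -!scalemxAr -!scalemxAl !scalerDr !scalerDl !scalerA addrACA.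
by rewrite !(mulrC (v _ _)).
Qed.

End Coefs.

Lemma map_act_tens (R S : comNzRingType) (f : {rmorphism R -> S}) g1 g2 g3 x :
  map_tens f (act_tens g1 g2 g3 x) =
  act_tens (map_mx f g1) (map_mx f g2) (map_mx f g3) (map_tens f x).
Proof.
apply/ffunP => p; rewrite !ffunE rmorph_sum; apply: eq_bigr => q _.
by rewrite !ffunE !mxE !rmorphM.
Qed.

Lemma map_cubic_coef (R S : comNzRingType) (f : {rmorphism R -> S}) x i :
  (i < 4)%N -> cubic_coef (map_tens f x) i = f (cubic_coef x i).
Proof. by move=> lti; rewrite !cubic_coefE // map_det_coef. Qed.

Lemma map_cubic_subst (R S : comNzRingType) (f : {rmorphism R -> S}) g c i :
  cubic_subst (map_mx f g) (fun n => f (c n)) i = f (cubic_subst g c i).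
Proof.
rewrite /cubic_subst !mxE.
by case: i => [|[|[|i]]]; rewrite !(rmorph_nat, rmorphXn, rmorphM, rmorphD).
Qed.

(** Equal values on R^2 would not give equal coefficients over a small ring, so the transformation
    rule of the form is applied over R[X], at the point (1, X) that defines [cubic_coef]. *)
Lemma cubic_coef_act (R : comNzRingType) (g1 g2 : 'M[R]_3) (g3 : 'M[R]_2) x i :
  (i < 4)%N -> cubic_coef (act_tens g1 g2 g3 x) i =
  \det g1 * \det g2 * cubic_subst g3 (cubic_coef x) i.
Proof.
move=> lti; rewrite {1}/cubic_coef map_act_tens cubic_form_act.
rewrite !det_map_mx -polyCM coefCM; congr (_ * _).
rewrite cubic_formE binary_cubic_subst -[RHS]binary_cubic_coef //.
congr (_`_i); rewrite /binary_cubic -!map_cubic_subst /cubic_subst.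
by rewrite !map_cubic_coef.
Qed.

Lemma P1_act (R : comNzRingType) (g1 g2 : 'M[R]_3) (g3 : 'M[R]_2) x :
  P1 (act_tens g1 g2 g3 x) = (\det g1 * \det g2) ^+ 4 * \det g3 ^+ 6 * P1 x.
Proof.
rewrite !P1E (eq_cubic_disc (cubic_coef_act g1 g2 g3 x)) cubic_disc_scale.
by rewrite cubic_disc_subst mulrA.
Qed.

(** * Group action and normal forms *)

Section Cofactor.
Variable R : comNzRingType.
Implicit Types (g : 'M[R]_3) (u v w y : 'cV[R]_3).

Lemma mulmx3E g v i : (g *m v) i 0 = g i 0 * v 0 0 + g i 1 * v 1 0 + g i 2 * v 2 0.
Proof. by rewrite mxE sum3E. Qed.

Lemma act_wedge2E g y : let c j := col j g in
  act_wedge2 g y = y 0 0 *: wedge2 (c 1) (c 2) + y 1 0 *: wedge2 (c 2) (c 0)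
    + y 2 0 *: wedge2 (c 0) (c 1).
Proof. by rewrite /act_wedge2 /basis sum3E -!colE ?add0r !ord3_eqs. Qed.

Lemma act_wedge2_wedge2 g u v :
  act_wedge2 g (wedge2 u v) = wedge2 (g *m u) (g *m v).
Proof.
rewrite act_wedge2E !mulmx_colE.
by apply/colP; elim/ord3P; rewrite !(wedge2E, vecE); ring.
Qed.

(** The adjugate identity: [g] acts on the exterior square by its cofactor matrix. *)
Lemma trmul_act_wedge2 g y : g^T *m act_wedge2 g y = \det g *: y.
Proof.
rewrite act_wedge2E det_cols; apply/colP; elim/ord3P;
  rewrite mulmx3E !(wedge2E, vecE) wedge3E ![g^T _ _]mxE ![col _ _ _ _]mxE; ring.
Qed.

Lemma wedge3_mulmx g u v w :
  wedge [:: g *m u; g *m v; g *m w] = \det g * wedge [:: u; v; w].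
Proof.
rewrite -det_mulmx; congr (\det _); apply/matrixP => i j.
rewrite mxE [RHS]mxE; case: j => [[|[|[|//]]] ltj] /=; rewrite mxE;
  by apply: eq_bigr => l _; rewrite [X in _ = _ * X]mxE.
Qed.

Lemma act_wedge2Z g a y : act_wedge2 g (a *: y) = a *: act_wedge2 g y.
Proof. by rewrite !act_wedge2E !vecE !scalerDr !scalerA. Qed.

Lemma act_wedge2D g y y' : act_wedge2 g (y + y') = act_wedge2 g y + act_wedge2 g y'.
Proof.
rewrite !act_wedge2E !vecE !scalerDl.
by rewrite [in RHS]addrACA; congr (_ + _); rewrite [in RHS]addrACA.
Qed.

Lemma act_wedge2M g h y : act_wedge2 (g *m h) y = act_wedge2 g (act_wedge2 h y).
Proof.
rewrite [act_wedge2 h y]act_wedge2E !act_wedge2D !act_wedge2Z !act_wedge2_wedge2.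
by rewrite act_wedge2E !colE !mulmxA.
Qed.

End Cofactor.

Section Action.
Variable k : fieldType.
Implicit Types (x : space k) (g : 'M[k]_3) (z : tens332 k).

Lemma act_wedge2_unit g y : g \in unitmx ->
  act_wedge2 g y = \det g *: ((invmx g)^T *m y).
Proof.
move=> gU; have gTU : g^T \in unitmx by rewrite unitmx_tr.
by rewrite trmx_inv -[LHS](mulKmx gTU) trmul_act_wedge2 scalemxAr.
Qed.

Lemma act_tensM (g1 g2 h1 h2 : 'M[k]_3) (g3 h3 : 'M[k]_2) z :
  act_tens g1 g2 g3 (act_tens h1 h2 h3 z) =
  act_tens (g1 *m h1) (g2 *m h2) (g3 *m h3) z.
Proof.
apply: slice_inj => l; rewrite !slice_act trmx_mul !mulmxA; congr (_ *m _).
under eq_bigr => l' _ do rewrite slice_act scalemxAl scalemxAr.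
rewrite -mulmx_suml -mulmx_sumr !mulmxA; congr (_ *m _ *m _).
under eq_bigr => l' _ do rewrite scaler_sumr.
rewrite exchange_big; apply: eq_bigr => l'' _ /=.
by rewrite mxE scaler_suml; apply: eq_bigr => l' _; rewrite scalerA.
Qed.

Lemma act_tens1 z : act_tens 1%:M 1%:M 1%:M z = z.
Proof.
apply: slice_inj => l; rewrite slice_act trmx1 mul1mx mulmx1.
rewrite (bigD1 l) //= mxE eqxx scale1r big1 ?addr0 // => l' ne.
by rewrite mxE eq_sym (negPf ne) scale0r.
Qed.

Lemma act_spaceM (g1 g2 h1 h2 : 'M[k]_3) (g3 h3 : 'M[k]_2) t t' x :
  act_space g1 g2 g3 t (act_space h1 h2 h3 t' x) =
  act_space (g1 *m h1) (g2 *m h2) (g3 *m h3) (t * t') x.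
Proof.
by rewrite /act_space /= act_tensM act_wedge2Z act_wedge2M scalerA.
Qed.

Lemma act_space1 x : act_space 1%:M 1%:M 1%:M 1 x = x.
Proof.
rewrite /act_space act_tens1 act_wedge2_unit ?unitmx1 // det1 invmx1 trmx1.
by rewrite mul1mx !scale1r; case: x.
Qed.

Lemma orbit_space_act (g1 g2 : 'M[k]_3) (g3 : 'M[k]_2) t x :
  g1 \in unitmx -> g2 \in unitmx -> g3 \in unitmx -> t != 0 ->
  orbit_space (act_space g1 g2 g3 t x) = orbit_space x.
Proof.
move=> g1U g2U g3U t0; apply/seteqP; split=> _ [h1 [h2 [h3 [s [h1U h2U h3U s0 ->]]]]].
  exists (h1 *m g1), (h2 *m g2), (h3 *m g3), (s * t).
  by rewrite act_spaceM !unitmx_mul h1U h2U h3U g1U g2U g3U mulf_neq0.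
exists (h1 *m invmx g1), (h2 *m invmx g2), (h3 *m invmx g3), (s / t).
rewrite act_spaceM !mulmxKV // divfK // !unitmx_mul !unitmx_inv.
by rewrite h1U h2U h3U g1U g2U g3U mulf_neq0 ?invr_eq0.
Qed.

Lemma orbit_space_self x : orbit_space x x.
Proof. by exists 1%:M, 1%:M, 1%:M, 1; rewrite act_space1 !unitmx1 oner_neq0. Qed.

Lemma orbit_tens_act (g1 g2 : 'M[k]_3) (g3 : 'M[k]_2) z :
  g1 \in unitmx -> g2 \in unitmx -> g3 \in unitmx ->
  orbit_tens (act_tens g1 g2 g3 z) = orbit_tens z.
Proof.
move=> g1U g2U g3U; apply/seteqP; split=> _ [h1 [h2 [h3 [h1U h2U h3U ->]]]].
  exists (h1 *m g1), (h2 *m g2), (h3 *m g3).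
  by rewrite act_tensM !unitmx_mul h1U h2U h3U g1U g2U g3U.
exists (h1 *m invmx g1), (h2 *m invmx g2), (h3 *m invmx g3).
by rewrite act_tensM !mulmxKV // !unitmx_mul !unitmx_inv h1U h2U h3U g1U g2U g3U.
Qed.

Lemma orbit_tens_self z : orbit_tens z z.
Proof. by exists 1%:M, 1%:M, 1%:M; rewrite act_tens1 !unitmx1. Qed.

Lemma exists_wedge3 (y : 'cV[k]_3) : y != 0 ->
  exists e f, wedge [:: y; e; f] != 0.
Proof.
move=> y0; have [i yi] : exists i, y i 0 != 0.
  by apply/cV0Pn.
exists (basis k (i + 1)), (basis k (i + 2)).
suff -> : wedge [:: y; basis k (i + 1); basis k (i + 2)] = y i 0 by [].
by elim/ord3P: i {yi}; rewrite ?add0r ?ord3_eqs wedge3E !mxE /=; ring.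
Qed.

Lemma p2_neq0_fst x : p2 x != 0 -> x.1 != 0.
Proof.
apply: contraNneq => x0; rewrite /p2 /halfdet x0 !vecE.
do !move: (wedge [:: _; _; _]) => ?; apply/eqP; ring.
Qed.

(** [p2_wedge] is transported instead of computing the character of P_2. The first component goes to
    a multiple of [N *m y] with [N] the inverse transpose of [g2], and applying the new slices to
    [N *m v] makes [g2] disappear. What remains of the action in the identity are invertible scalar
    factors. *)
Lemma p2_act_neq0 (g1 g2 : 'M[k]_3) (g3 : 'M[k]_2) t x :
  g1 \in unitmx -> g2 \in unitmx -> g3 \in unitmx -> t != 0 ->
  p2 x != 0 -> p2 (act_space g1 g2 g3 t x) != 0.
Proof.
move=> g1U g2U g3U t0 px.
have [e [f wef]] := exists_wedge3 (p2_neq0_fst px).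
have d1 : \det g1 != 0 by rewrite -unitfE -unitmxE.
have d2 : \det g2 != 0 by rewrite -unitfE -unitmxE.
have d3 : \det g3 != 0 by rewrite -unitfE -unitmxE.
pose N := (invmx g2)^T.
have := p2_wedge (act_space g1 g2 g3 t x) (N *m e) (N *m f).
set A := slice x.2 0; set B := slice x.2 1; set y := x.1.
pose A' := \sum_l g3 0 l *: slice x.2 l; pose B' := \sum_l g3 1 l *: slice x.2 l.
rewrite /= !slice_act act_wedge2_unit // scalerA -/A' -/B' -/N -/y.
have gN : g2^T *m N = 1%:M by rewrite /N -trmx_mul mulVmx ?trmx1.
have sN (M : 'M[k]_3) v : g1 *m M *m g2^T *m (N *m v) = g1 *m (M *m v).
  by rewrite -!mulmxA (mulmxA g2^T) gN mul1mx.
have polar_sc s (M M' : 'M[k]_3) (v w : 'cV[k]_3) : polar M M' (s *: v) w = s *: polar M M' v w.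
  by rewrite /polar -!scalemxAr !wedge2Zl scalerBr.
rewrite polar_sc -!scalemxAr polar_sc wedge2Zl wedge2Zr /polar !sN -!act_wedge2_wedge2.
have pencil (u v u' v' : 'cV[k]_3) :
    wedge2 (g3 0 0 *: u + g3 0 1 *: v) (g3 1 0 *: u' + g3 1 1 *: v') -
    wedge2 (g3 1 0 *: u + g3 1 1 *: v) (g3 0 0 *: u' + g3 0 1 *: v') =
    \det g3 *: (wedge2 u v' - wedge2 v u').
  by rewrite det2E; apply/colP; elim/ord3P; rewrite !(wedge2E, vecE); ring.
have pencil1 (u v : 'cV[k]_3) :
    wedge2 (g3 0 0 *: u + g3 0 1 *: v) (g3 1 0 *: u + g3 1 1 *: v) =
    \det g3 *: (wedge2 u v).
  by rewrite det2E; apply/colP; elim/ord3P; rewrite !(wedge2E, vecE); ring.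
have act_sub (u v : 'cV[k]_3) : act_wedge2 g1 u - act_wedge2 g1 v = act_wedge2 g1 (u - v).
  by rewrite !act_wedge2_unit // -scalerBr -mulmxBr.
rewrite !act_sub.
have mulP (l : 'I_2) v : (\sum_l' g3 l l' *: slice x.2 l') *m v =
    g3 l 0 *: (A *m v) + g3 l 1 *: (B *m v).
  by rewrite sum2E mulmxDl -!scalemxAl.
rewrite /A' /B' !mulP !pencil pencil1.
rewrite !act_wedge2_unit // -!scalemxAr.
rewrite !scalerA.
set s := t * \det g2.
have w3Z a b c (u v w : 'cV[k]_3) :
    wedge [:: a *: u; b *: v; c *: w] = a * b * c * wedge [:: u; v; w].
  by rewrite !wedge3E !vecE; ring.
rewrite w3Z wedge3Z !wedge3_mulmx -p2_wedge -/A -/B -/y => E.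
have dV (g : 'M[k]_3) : g \in unitmx -> \det (invmx g)^T != 0.
  by move=> gU; rewrite det_tr -unitfE -unitmxE unitmx_inv.
apply: contra_eq_neq E => ->; rewrite mulr0 eq_sym.
by rewrite !mulf_neq0 ?dV.
Qed.

End Action.

Section NormalForm.
Variable k : fieldType.
Implicit Types (x : space k) (g : 'M[k]_3) (z : tens332 k).

Definition mat3 (s : seq (seq k)) : 'M[k]_3 := \matrix_(i, j) (nth [::] s i)`_j.

(* v0 A + v1 B is [v0, - c2 v0 - c3 v1, 0; v1, 0, - c0 v0 - c1 v1; 0, v0, v1]. *)
Definition normal_form (c : nat -> k) : tens332 k := [ffun p =>
  (if p.2 == 0 then mat3 [:: [:: 1; - c 2%N; 0]; [:: 0; 0; - c 0%N]; [:: 0; 1; 0]]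
   else mat3 [:: [:: 0; - c 3%N; 0]; [:: 1; 0; - c 1%N]; [:: 0; 0; 1]]) p.1.1 p.1.2].

Lemma slice_normal_form c :
  ((slice (normal_form c) 0 =
     mat3 [:: [:: 1; (- c 2%N)%R; 0]; [:: 0; 0; (- c 0%N)%R]; [:: 0; 1; 0]]) *
  (slice (normal_form c) 1 =
     mat3 [:: [:: 0; (- c 3%N)%R; 0]; [:: 1; 0; (- c 1%N)%R]; [:: 0; 0; 1]]))%type.
Proof. by split; apply/matrixP => i j; rewrite mxE ffunE. Qed.

Lemma cubic_coef_normal_form c i : (i < 4)%N -> cubic_coef (normal_form c) i = c i.
Proof.
move=> lti; rewrite cubic_coefE // /det_coef !slice_normal_form !wedge3E !mxE /=.
by case: i lti => [|[|[|[|//]]]] _; ring.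
Qed.

Lemma eq_normal_form c c' :
  (forall i, (i < 4)%N -> c i = c' i) -> normal_form c = normal_form c'.
Proof. by move=> e; rewrite /normal_form !e. Qed.

Lemma slice_act_id (g1 g2 : 'M[k]_3) z l :
  slice (act_tens g1 g2 1%:M z) l = g1 *m slice z l *m g2^T.
Proof.
rewrite slice_act; congr (_ *m _ *m _).
rewrite (bigD1 l) //= mxE eqxx scale1r big1 ?addr0 // => l' ne.
by rewrite mxE eq_sym (negPf ne) scale0r.
Qed.

(** With the third matrix equal to 1, the reduction changes the cubic form only by the scalar
    [\det g1 * \det g2]. *)
Definition equiv1 x x' := exists g1 g2 t,
  [/\ g1 \in unitmx, g2 \in unitmx, t != 0 & x' = act_space g1 g2 1%:M t x].

Lemma equiv1_trans x x1 x2 : equiv1 x x1 -> equiv1 x1 x2 -> equiv1 x x2.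
Proof.
move=> [g1 [g2 [t [g1U g2U t0 ->]]]] [h1 [h2 [s [h1U h2U s0 ->]]]].
exists (h1 *m g1), (h2 *m g2), (s * t).
by rewrite act_spaceM mulmx1 !unitmx_mul h1U g1U h2U g2U mulf_neq0.
Qed.

Lemma equiv1_p2 x y : equiv1 x y -> p2 x != 0 -> p2 y != 0.
Proof. by move=> [g1 [g2 [t [? ? ? ->]]]]; apply: p2_act_neq0; rewrite ?unitmx1. Qed.

Definition cols3 (u v w : 'cV[k]_3) : 'M[k]_3 := \matrix_(i, j) [:: u; v; w]`_j i 0.

Lemma cols3_basis u v w : ((cols3 u v w *m basis k 0 = u) *
  (cols3 u v w *m basis k 1 = v) * (cols3 u v w *m basis k 2 = w))%type.
Proof. by rewrite /basis -!colE; do !split; apply/colP => i; rewrite !mxE. Qed.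

Lemma cols3_unit u v w : wedge [:: u; v; w] != 0 -> cols3 u v w \in unitmx.
Proof. by rewrite unitmxE unitfE. Qed.

Lemma normalize_fst x : p2 x != 0 -> exists2 x', equiv1 x x' & x'.1 = basis k 0.
Proof.
move=> px; have [e [f]] := exists_wedge3 (p2_neq0_fst px); set y := x.1 => w0.
have QU := cols3_unit w0; set Q := cols3 y e f in QU.
(* On the exterior square [Q^T] acts as [\det Q] times the inverse of [Q], and [Q] sends the first
   basis vector to [y]. *)
exists (act_space 1%:M Q^T 1%:M (\det Q)^-1 x).
  exists 1%:M, Q^T, (\det Q)^-1.
  by rewrite unitmx1 unitmx_tr QU invr_eq0 -unitfE -unitmxE.
rewrite /= act_wedge2_unit ?unitmx_tr // det_tr scalerA mulVf; last by rewrite -unitfE -unitmxE.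
by rewrite scale1r trmx_inv trmxK -/y -[in LHS]((cols3_basis y e f).1.1) mulKmx.
Qed.

Lemma wedge3_basis (u v : 'cV[k]_3) i : wedge [:: u; v; basis k i] = wedge2 u v i 0.
Proof. by elim/ord3P: i; rewrite wedge3E wedge2E !mxE /=; ring. Qed.

Lemma normalize_snd x : p2 x != 0 -> x.1 = basis k 0 ->
  exists2 x', equiv1 x x' & [/\ x'.1 = basis k 0,
    slice x'.2 0 *m basis k 0 = basis k 0 & slice x'.2 1 *m basis k 0 = basis k 1].
Proof.
move=> px x1; have := p2_wedge x (basis k 1) (basis k 2); rewrite x1 /=.
set u := slice x.2 0 *m _; set v := slice x.2 1 *m _ => E.
(* If [u] and [v] were dependent, the first entry of the determinant in [p2_wedge] would be 0 and so
   would [p2 x]. A basis vector [i] with non-zero coordinate then completes [u], [v] to a basis. *)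
have [i mi] : exists i, wedge2 u v i 0 != 0.
  apply/cV0Pn; apply: contra_neq px => m0.
  move: E; rewrite m0 wedge3_basis !wedge2E !mxE /= => E.
  transitivity (wedge [:: (0 : 'cV[k]_3); polar (slice x.2 0) (slice x.2 1) (basis k 0) (basis k 1);
     polar (slice x.2 0) (slice x.2 1) (basis k 0) (basis k 2)]).
    by rewrite -E; ring.
  by rewrite wedge3E !vecE; ring.
rewrite -wedge3_basis in mi; have GU := cols3_unit mi.
set G := cols3 u v _ in GU.
exists (act_space (invmx G) 1%:M 1%:M 1 x).
  by exists (invmx G), 1%:M, 1; rewrite unitmx_inv unitmx1 oner_neq0.
rewrite /= !slice_act_id trmx1 !mulmx1 -!mulmxA -/u -/v.
rewrite act_wedge2_unit ?unitmx1 // det1 invmx1 trmx1 mul1mx !scale1r; split=> //.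
  by rewrite -[in LHS]((cols3_basis u v (basis k i)).1.1) mulKmx.
by rewrite -[in LHS]((cols3_basis u v (basis k i)).1.2) mulKmx.
Qed.

(** The vector [m] is now the last basis vector, so P_2 reduces to the minor formed by the last rows
    of the two slices outside column 0. *)
Lemma p2_normalized x (A := slice x.2 0) (B := slice x.2 1) : x.1 = basis k 0 ->
  A *m basis k 0 = basis k 0 -> B *m basis k 0 = basis k 1 ->
  p2 x = A 2 1 * B 2 2 - A 2 2 * B 2 1.
Proof.
move=> x1 eA eB; have := p2_wedge x (basis k 1) (basis k 2).
rewrite x1 /= -/A -/B /polar eA eB /basis -!colE.
by rewrite !wedge3E !(wedge2E, vecE) !mxE /= => E; rewrite -[p2 x]mul1r; ring: E.
Qed.

Lemma act_fst_basis0 g1 (Q : 'M[k]_3) x : Q \in unitmx -> Q *m basis k 0 = basis k 0 ->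
  x.1 = basis k 0 -> (act_space g1 Q^T 1%:M (\det Q)^-1 x).1 = basis k 0.
Proof.
move=> QU Q0 /= ->; rewrite act_wedge2_unit ?unitmx_tr // det_tr scalerA mulVf; last first.
  by rewrite -unitfE -unitmxE.
by rewrite scale1r trmx_inv trmxK -[in LHS]Q0 mulKmx.
Qed.

Lemma normalize_row x (A := slice x.2 0) (B := slice x.2 1) : x.1 = basis k 0 ->
  A *m basis k 0 = basis k 0 -> B *m basis k 0 = basis k 1 ->
  A 2 1 * B 2 2 - A 2 2 * B 2 1 != 0 ->
  exists2 x', equiv1 x x' &
    let A' := slice x'.2 0 in let B' := slice x'.2 1 in
    [/\ x'.1 = basis k 0, A' *m basis k 0 = basis k 0 & B' *m basis k 0 = basis k 1] /\
    [/\ A' 2 1 = 1, A' 2 2 = 0, B' 2 1 = 0 & B' 2 2 = 1].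
Proof.
set d := _ - _ => x1 eA eB d0.
(* The inverse is kept as a variable [e], so that [ring] followed by this one relation suffices. *)
have [e de] : exists e, d * e = 1 by exists d^-1; rewrite mulfV.
(* The lower right block is the inverse of the 2 x 2 matrix of last rows; the first basis vector
   stays fixed. *)
pose Q := mat3 [:: [:: 1; 0; 0]; [:: 0; B 2 2 * e; - A 2 2 * e]; [:: 0; - B 2 1 * e; A 2 1 * e]].
have detQ : \det Q = e.
  by transitivity (d * e * e); [rewrite /d det3E !mxE /=; ring | rewrite de mul1r].
have e0 : e != 0 by apply: contra_eq_neq de => ->; rewrite mulr0 eq_sym oner_neq0.
have QU : Q \in unitmx by rewrite unitmxE detQ unitfE.
have Q0 : Q *m basis k 0 = basis k 0.
  by rewrite /basis -colE; apply/colP; elim/ord3P; rewrite !mxE.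
exists (act_space 1%:M Q^T 1%:M (\det Q)^-1 x).
  by exists 1%:M, Q^T, (\det Q)^-1; rewrite unitmx1 unitmx_tr QU detQ invr_eq0.
split; first split; first exact: act_fst_basis0.
- by rewrite /= slice_act_id trmxK mul1mx -mulmxA Q0.
- by rewrite /= slice_act_id trmxK mul1mx -mulmxA Q0.
have eE (M : 'M[k]_3) (i j : 'I_3) : (M *m Q) i j = M i 0 * Q 0 j + M i 1 * Q 1 j + M i 2 * Q 2 j.
  by rewrite mxE sum3E.
have a20 : A 2 0 = 0 by move/colP: eA => /(_ 2); rewrite /basis -colE !mxE.
have b20 : B 2 0 = 0 by move/colP: eB => /(_ 2); rewrite /basis -colE !mxE.
rewrite /= !slice_act_id !trmxK !mul1mx !eE -/A -/B a20 b20 ![Q _ _]mxE /=.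
by split; rewrite -?[RHS]de /d; ring.
Qed.

Lemma normalize_entries x (A := slice x.2 0) (B := slice x.2 1) :
  [/\ x.1 = basis k 0, A *m basis k 0 = basis k 0 & B *m basis k 0 = basis k 1] ->
  [/\ A 2 1 = 1, A 2 2 = 0, B 2 1 = 0 & B 2 2 = 1] ->
  exists c, equiv1 x (basis k 0, normal_form c).
Proof.
move=> [x1 eA eB] [a21 a22 b21 b22].
have [a00 a10 a20] : [/\ A 0 0 = 1, A 1 0 = 0 & A 2 0 = 0].
  by move/colP: eA => eA; split; move: (eA 0) (eA 1) (eA 2); rewrite /basis -colE !mxE.
have [b00 b10 b20] : [/\ B 0 0 = 0, B 1 0 = 1 & B 2 0 = 0].
  by move/colP: eB => eB; split; move: (eB 0) (eB 1) (eB 2); rewrite /basis -colE !mxE.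
(* [Q] adds multiples of column 0 to clear the entries (1, 1) of B and (0, 2) of A; [g] adds
   multiples of the last row to clear (0, 2) of B and (1, 1) of A. The four entries left over are
   the negatives of the coefficients [c]. *)
pose Q := mat3 [:: [:: 1; - B 1 1; - A 0 2]; [:: 0; 1; 0]; [:: 0; 0; 1]].
pose g := mat3 [:: [:: 1; 0; - B 0 2]; [:: 0; 1; - A 1 1]; [:: 0; 0; 1]].
have detQ : \det Q = 1 by rewrite det3E !mxE /=; ring.
have detg : \det g = 1 by rewrite det3E !mxE /=; ring.
have QU : Q \in unitmx by rewrite unitmxE detQ unitr1.
have gU : g \in unitmx by rewrite unitmxE detg unitr1.
have Q0 : Q *m basis k 0 = basis k 0.
  by rewrite /basis -colE; apply/colP; elim/ord3P; rewrite !mxE.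
pose c n := match n with
  | 0 => - (A 1 2) | 1 => - (B 1 2 - A 0 2 - A 1 1)
  | 2 => - (A 0 1 - B 1 1 - B 0 2) | _ => - B 0 1 end.
exists c, g, Q^T, (\det Q)^-1; rewrite gU unitmx_tr QU detQ invr1 oner_neq0; split=> //.
have := act_fst_basis0 g QU Q0 x1; rewrite detQ invr1.
move=> fE; rewrite [RHS]surjective_pairing fE; congr (_, _); apply: slice_inj.
elim/ord2P; rewrite slice_act_id trmxK ?slice_normal_form.
- rewrite -/A; apply/matrixP => i j; rewrite [RHS]mxE sum3E ![(g *m A) _ _]mxE !sum3E.
  rewrite ![g _ _]mxE ![Q _ _]mxE [LHS]mxE.
  elim/ord3P: i; elim/ord3P: j; rewrite /= ?(a21, a22, a00, a10, a20); ring.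
rewrite -/B; apply/matrixP => i j; rewrite [RHS]mxE sum3E ![(g *m B) _ _]mxE !sum3E.
rewrite ![g _ _]mxE ![Q _ _]mxE [LHS]mxE.
elim/ord3P: i; elim/ord3P: j; rewrite /= ?(b21, b22, b00, b10, b20); ring.
Qed.

Lemma scale_normal_form (a : k) c : a != 0 ->
  exists g1 g2 t, [/\ g1 \in unitmx, g2 \in unitmx, t != 0 &
   (basis k 0, normal_form (fun n => a * c n)) =
     act_space g1 g2 1%:M t (basis k 0, normal_form c)].
Proof.
move=> a0.
(* The coefficients all sit in rows 0 and 1, so [g] multiplies them by [a]; it also scales the two
   units in column 0, which [h] restores. *)
pose g := mat3 [:: [:: a; 0; 0]; [:: 0; a; 0]; [:: 0; 0; 1]].
pose h := mat3 [:: [:: a^-1; 0; 0]; [:: 0; 1; 0]; [:: 0; 0; 1]].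
have gU : g \in unitmx.
  by rewrite unitmxE unitfE det3E !mxE /= !(mulr0, mul0r, mulr1, subr0, addr0) mulf_neq0.
have hU : h \in unitmx.
  by rewrite unitmxE unitfE det3E !mxE /= !(mulr0, mul0r, mulr1, subr0, addr0) invr_eq0.
exists g, h, 1; rewrite gU hU oner_neq0; split=> //; congr (_, _).
  rewrite scale1r act_wedge2E; apply/colP; elim/ord3P; rewrite !(vecE, wedge2E) !mxE /=; ring.
have aV : a * a^-1 = 1 by rewrite mulfV.
apply: slice_inj; elim/ord2P; rewrite slice_act_id ?slice_normal_form /=;
 apply/matrixP => i j; rewrite [RHS]mxE sum3E ![(g *m _) _ _]mxE !sum3E;
 rewrite !mxE;
 elim/ord3P: i; elim/ord3P: j; rewrite /= ?(mulr0, mul0r, addr0, add0r, mulr1, mul1r, aV, mulrN) //.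
Qed.

Theorem orbit_normal_form x : p2 x != 0 ->
  orbit_space x = orbit_space (basis k 0, normal_form (cubic_coef x.2)).
Proof.
move=> px; have [x1 e1 x1E] := normalize_fst px.
have [x2 e2 [x2E a0 b0]] := normalize_snd (equiv1_p2 e1 px) x1E.
have := equiv1_p2 e2 (equiv1_p2 e1 px); rewrite p2_normalized // => d0.
have [x3 e3 [n3 r3]] := normalize_row x2E a0 b0 d0.
have [c e4] := normalize_entries n3 r3.
have := equiv1_trans e1 (equiv1_trans e2 (equiv1_trans e3 e4)).
move=> [g1 [g2 [t [g1U g2U t0 e]]]].
rewrite -(orbit_space_act x g1U g2U (unitmx1 _ _) t0) -e.
(* The reduction reaches the normal form of [a] times the cubic form of [x]; [scale_normal_form]
   removes this factor. *)
pose a := \det g1 * \det g2.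
have a0' : a != 0 by rewrite mulf_neq0 // -unitfE -unitmxE.
have cE i : (i < 4)%N -> c i = a * cubic_coef x.2 i.
  move=> lti; rewrite -(cubic_coef_normal_form _ lti).
  have -> : normal_form c = act_tens g1 g2 1%:M x.2 by case: e.
  rewrite cubic_coef_act // -/a; congr (_ * _); rewrite /cubic_subst !mxE /=.
  by case: i lti => [|[|[|[|//]]]] _; ring.
rewrite (eq_normal_form cE); have [h1 [h2 [s [h1U h2U s0 ->]]]] := scale_normal_form (cubic_coef x.2) a0'.
by rewrite orbit_space_act ?unitmx1.
Qed.

End NormalForm.

(** * Existence of non-degenerate points *)

(** The linear forms [m A] and [m B] vanish on [x.1], because [m] is orthogonal to both images of
    it. They live on the quotient by [x.1], and P_2 measures their independence there. *)
Lemma p2_dot (R : comNzRingType) (x : space R) e f :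
  let A := slice x.2 0 in let B := slice x.2 1 in
  let m := wedge2 (A *m x.1) (B *m x.1) in
  wedge [:: x.1; e; f] * p2 x =
  wedge21 m (A *m e) * wedge21 m (B *m f) - wedge21 m (A *m f) * wedge21 m (B *m e).
Proof.
move=> A B m; rewrite p2_wedge -/A -/B /polar -/m.
move: (A *m e) (A *m f) (B *m e) (B *m f) => ae af be bf.
by rewrite /m; move: (A *m _) (B *m _) => a b; rewrite !wedge21E wedge3E !(wedge2E, vecE); ring.
Qed.

Section Existence.
Variable k : fieldType.
Implicit Types (x : space k) (g : 'M[k]_3) (z : tens332 k).

Lemma wedge2_eq0 (a b : 'cV[k]_3) : wedge2 a b = 0 ->
  exists2 v : 'cV[k]_2, v != 0 & v 0 0 *: a + v 1 0 *: b = 0.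
Proof.
move=> ab0; have [->|a0] := eqVneq a 0.
  exists (basis k 0); first by apply/cV0Pn; exists 0; rewrite mxE oner_neq0.
  by rewrite !mxE /= scaler0 scale0r addr0.
have [i ai] : exists i, a i 0 != 0 by apply/cV0Pn.
exists (\col_(j < 2) if j == 0 then b i 0 else - a i 0).
  by apply/cV0Pn; exists 1; rewrite mxE oppr_eq0.
rewrite !mxE /=; move/colP: ab0 => ab0; have := (ab0 0, ab0 1, ab0 2).
rewrite !wedge2E !vecE => [[[e0 e1] e2]].
apply/colP => j; rewrite !vecE; elim/ord3P: i {ai}; elim/ord3P: j;
  first [ring | rewrite -e0; ring | rewrite -e1; ring | rewrite -e2; ring
   | rewrite -[RHS]oppr0 -e0; ring | rewrite -[RHS]oppr0 -e1; ring | rewrite -[RHS]oppr0 -e2; ring].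
Qed.

Lemma wedge21_mulmx (m : 'cV[k]_3) (M : 'M[k]_3) :
  m != 0 -> (forall i, wedge21 m (M *m basis k i) = 0) -> \det M = 0.
Proof.
move=> m0 mM; apply/eqP/det0P; exists m^T; first by rewrite trmx_eq0.
apply/rowP => j; have := mM j; rewrite wedge21E /basis -colE !mxE => e.
by rewrite sum3E !mxE.
Qed.

(** If [m] vanished, a member of the pencil would kill [y]. If P_2 vanished, the forms [m A] and
    [m B] would be dependent by [p2_dot], so [m] would be a left null vector of a member of the
    pencil. Either way the cubic form would have a zero. *)
Lemma p2_no_root z : (forall v : 'cV[k]_2, v != 0 -> cubic_form z v != 0) ->
  p2 (basis k 0, z) != 0.
Proof.
move=> nr; set y := basis k 0; pose A := slice z 0; pose B := slice z 1.
have Fsing (v : 'cV[k]_2) : v != 0 -> \det (v 0 0 *: A + v 1 0 *: B) != 0 by exact: nr.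
pose m := wedge2 (A *m y) (B *m y).
have m0 : m != 0.
  apply/eqP => /wedge2_eq0 [v v0 e]; have /eqP := Fsing v v0; apply.
  apply/eqP; rewrite -det_tr; apply/det0P; exists y^T.
    by rewrite trmx_eq0; apply/cV0Pn; exists 0; rewrite mxE oner_neq0.
  by rewrite -trmx_mul mulmxDl -!scalemxAl e trmx0.
have D2 := p2_dot (y, z) (basis k 1) (basis k 2); rewrite /= -/A -/B -/m in D2.
apply/eqP => p0; move: D2; rewrite p0 mulr0 => /esym D2.
pose M : 'M[k]_2 := \matrix_(l, j) wedge21 m ((if l == 0 then A else B) *m basis k (lift 0 j)).
have /eqP/det0P [v v0 vM] : \det M = 0.
  by rewrite det2E !mxE /= !ord3_lifts.
have := Fsing v^T; rewrite trmx_eq0 => /(_ v0)/eqP; apply.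
apply: (wedge21_mulmx m0) => i; rewrite mulmxDl -!scalemxAl !mxE.
have w21 (a b : k) u u' : wedge21 m (a *: u + b *: u') = a * wedge21 m u + b * wedge21 m u'.
  by rewrite !wedge21E !vecE; ring.
rewrite w21; case: (unliftP 0 i) => [j ->|->].
  by move/rowP: vM => /(_ j); rewrite mxE sum2E !mxE.
by rewrite -/y /m !wedge21E !wedge2E; ring.
Qed.

Lemma exists_p2_act (g1 g2 : 'M[k]_3) (g3 : 'M[k]_2) z :
  g1 \in unitmx -> g2 \in unitmx -> g3 \in unitmx ->
  (exists y, p2 (y, act_tens g1 g2 g3 z) != 0) -> exists y, p2 (y, z) != 0.
Proof.
move=> g1U g2U g3U [y py]; exists (1 *: act_wedge2 (invmx g2) y).
have := @p2_act_neq0 _ (invmx g1) (invmx g2) (invmx g3) 1 _ _ _ _ _ py.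
by rewrite !unitmx_inv oner_neq0 /act_space /= act_tensM !mulVmx // act_tens1; apply.
Qed.

(** [A] is 0 plus a 2 x 2 block N, and [b1], [b2] are the coordinates of C h, where C is [m] times
    the Schur complement of the corner [m] in [B]. The first coordinate of [y] is chosen so that
    [B *m y] has first coordinate [m]. The last factor is then minus the determinant of N h and C
    h. *)
Lemma p2_block z (A := slice z 0) (B := slice z 1) (h1 h2 : k) :
  [/\ A 0 0 = 0, A 0 1 = 0, A 0 2 = 0, A 1 0 = 0 & A 2 0 = 0] ->
  let m := B 0 0 in
  let y := \col_(i < 3) [:: 1 - B 0 1 * h1 - B 0 2 * h2; m * h1; m * h2]`_i in
  let n1 := A 1 1 * h1 + A 1 2 * h2 in let n2 := A 2 1 * h1 + A 2 2 * h2 in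
  let b1 := (m * B 1 1 - B 1 0 * B 0 1) * h1 + (m * B 1 2 - B 1 0 * B 0 2) * h2 in
  let b2 := (m * B 2 1 - B 2 0 * B 0 1) * h1 + (m * B 2 2 - B 2 0 * B 0 2) * h2 in
  p2 (y, z) = m ^+ 3 * (A 1 1 * A 2 2 - A 1 2 * A 2 1) * (n2 * b1 - n1 * b2).
Proof.
move=> [a00 a01 a02 a10 a20] m y n1 n2 b1 b2.
rewrite /p2 /= -/A -/B /halfdet !wedge3E.
rewrite /nvec /svec !(vecE, wedge2E) ![col _ _ _ _]mxE ![y _ _]mxE /=.
rewrite a00 a01 a02 a10 a20 /b1 /b2 /n1 /n2 /m.
ring.
Qed.

(** The determinant of N h and C h is a binary quadratic form in [h] with coefficients [al], [be],
    [ga], whose discriminant divides [P1 z]. It is thus not the zero form, and such a form is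
    non-zero at (1, 0), (0, 1) or (1, 1), even over the field with two elements. *)
Lemma exists_p2_block z : P1 z != 0 ->
  [/\ slice z 0 0 0 = 0, slice z 0 0 1 = 0, slice z 0 0 2 = 0, slice z 0 1 0 = 0
    & slice z 0 2 0 = 0] -> exists y, p2 (y, z) != 0.
Proof.
set A := slice z 0; set B := slice z 1 => pz Ab.
have [a00 a01 a02 a10 a20] := Ab.
pose m := B 0 0; pose dN := A 1 1 * A 2 2 - A 1 2 * A 2 1.
pose c11 := m * B 1 1 - B 1 0 * B 0 1; pose c12 := m * B 1 2 - B 1 0 * B 0 2.
pose c21 := m * B 2 1 - B 2 0 * B 0 1; pose c22 := m * B 2 2 - B 2 0 * B 0 2.
pose al := A 1 1 * c21 - A 2 1 * c11.
pose be := A 1 1 * c22 + A 1 2 * c21 - A 2 1 * c12 - A 2 2 * c11.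
pose ga := A 1 2 * c22 - A 2 2 * c12.
have P1E' : P1 z = (m * dN) ^+ 2 * (be ^+ 2 - 4 * al * ga).
  rewrite P1E (eq_cubic_disc (@cubic_coefE _ z)) /cubic_disc /det_coef.
  rewrite !wedge3E ![col _ _ _ _]mxE -/A -/B a00 a01 a02 a10 a20.
  by rewrite /be /al /ga /c11 /c12 /c21 /c22 /dN /m; ring.
have mdN0 : m * dN != 0.
  by apply: contra_neq pz => e; rewrite P1E' e expr0n mul0r.
rewrite mulf_eq0 in mdN0.
have bl h1 h2 := p2_block h1 h2 Ab; rewrite -/A -/B /= in bl.
have q0 h1 h2 : al * h1 ^+ 2 + be * h1 * h2 + ga * h2 ^+ 2 != 0 -> exists y, p2 (y, z) != 0.
  move=> q; have := bl h1 h2; set y := \col_ _ _ => pE; exists y; rewrite pE; apply: mulf_neq0.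
    by move/norP: mdN0 => [? ?]; rewrite mulf_neq0 ?expf_neq0.
  apply: contra_neq q => q; apply/eqP; rewrite -oppr_eq0 -q; apply/eqP.
  by rewrite /be /al /ga /c11 /c12 /c21 /c22 /m; ring.
have [al0|al0] := eqVneq al 0; last first.
  by apply: (q0 1 0); have -> : al * 1 ^+ 2 + be * 1 * 0 + ga * 0 ^+ 2 = al by ring.
have [ga0|ga0] := eqVneq ga 0; last first.
  by apply: (q0 0 1); have -> : al * 0 ^+ 2 + be * 0 * 1 + ga * 1 ^+ 2 = ga by ring.
apply: (q0 1 1); apply: contra_neq pz => e; rewrite P1E' al0.
have be0 : be = 0 by rewrite -e al0 ga0; ring.
by rewrite be0; ring.
Qed.

Theorem exists_p2_neq0 z : P1 z != 0 -> exists y, p2 (y, z) != 0.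
Proof.
move=> pz; case: (pselect (exists2 v : 'cV[k]_2, v != 0 & cubic_form z v = 0)); last first.
  move=> nr; exists (basis k 0); apply: p2_no_root => v v0.
  by apply/eqP => Fv; apply: nr; exists v.
move=> [v v0 Fv].
(* Moving the zero to (1, 0) makes the first slice singular. *)
have [g3 g3U g3v] : exists2 g3 : 'M[k]_2, g3 \in unitmx & g3^T *m basis k 0 = v.
  have [v00|v00] := eqVneq (v 0 0) 0.
    have v1 : v 1 0 != 0.
      by apply: contra_neq v0 => e; apply/colP; elim/ord2P; rewrite mxE.
    exists (\matrix_(i, j) if i == 0 then v j 0 else (i != j)%:R).
      by rewrite unitmxE unitfE det2E !mxE /= v00 mul0r sub0r mulr1 oppr_eq0.
    by rewrite /basis -colE; apply/colP => i; rewrite !mxE.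
  exists (\matrix_(i, j) if i == 0 then v j 0 else (i == j)%:R).
    by rewrite unitmxE unitfE det2E !mxE /= mulr0 subr0 mulr1.
  by rewrite /basis -colE; apply/colP => i; rewrite !mxE.
pose z1 := act_tens 1%:M 1%:M g3 z; pose A := slice z1 0.
have A0 : \det A = 0.
  have := cubic_form_act 1%:M 1%:M g3 z (basis k 0).
  by rewrite g3v Fv mulr0 /cubic_form -/z1 !mxE /= scale1r scale0r addr0.
have [p p0 pA] : exists2 v : 'rV_3, v != 0 & v *m A = 0 by apply/det0P/eqP.
have [q q0 qA] : exists2 v : 'rV_3, v != 0 & v *m A^T = 0.
  by apply/det0P; rewrite det_tr A0.
have p0' : p^T != 0 by rewrite trmx_eq0.
have q0' : q^T != 0 by rewrite trmx_eq0.
have [p1 [p2' wp]] := exists_wedge3 p0'; have [q1 [q2 wq]] := exists_wedge3 q0'.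
(* The first columns of [P] and [Q] are a left and a right null vector of [A], so row 0 and column 0
   of [P^T *m A *m Q] vanish. *)
have PU := cols3_unit wp; set P := cols3 _ _ _ in PU.
have QU := cols3_unit wq; set Q := cols3 _ _ _ in QU.
have PA j : (P^T *m A *m Q) 0 j = 0.
  have -> : (P^T *m A *m Q) 0 j = (p *m A *m Q) 0 j.
    rewrite !mxE; apply: eq_bigr => i _; rewrite !mxE; congr (_ * _).
    by apply: eq_bigr => l _; rewrite !mxE.
  by rewrite pA mul0mx mxE.
have AQ i : (P^T *m A *m Q) i 0 = 0.
  have -> : (P^T *m A *m Q) i 0 = (P^T *m (q *m A^T)^T) i 0.
    rewrite trmx_mul trmxK -mulmxA !mxE; apply: eq_bigr => l _; congr (_ * _).
    by rewrite !mxE; apply: eq_bigr => a _; rewrite !mxE.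
  by rewrite qA trmx0 mulmx0 mxE.
apply: (@exists_p2_act 1%:M 1%:M g3); rewrite ?unitmx1 // -/z1.
apply: (@exists_p2_act P^T Q^T 1%:M); rewrite ?unitmx1 ?unitmx_tr //.
apply: exists_p2_block; last by rewrite !slice_act_id trmxK -/A; split.
rewrite !P1_act !mulf_neq0 ?expf_neq0 ?mulf_neq0 // -?unitfE -?unitmxE ?unitmx1 ?unitmx_tr //.
Qed.

End Existence.

(** * Orbits in [U] and semistable orbits *)

Section OrbitSpaceBijection.
Variable k : fieldType.

Theorem orbit_space_bijection : induces_bij (U P2_poly) (@orbit_space k)
  (@orbit_tens k @` ss332 k) (fun x => orbit_tens x.2).
Proof.
exists (fun O => [set z | exists2 x, O x & z = x.2]).
  move=> x Ux; apply/seteqP; split=> [_ [_ [g1 [g2 [g3 [t [? ? ? _ ->]]]]] ->]|_ [g1 [g2 [g3 [? ? ? ->]]]]].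
    by exists g1, g2, g3.
  exists (act_space g1 g2 g3 1 x) => //.
  by exists g1, g2, g3, 1; rewrite oner_neq0.
have fE (x : space k) : [set z | exists2 x', orbit_space x x' & z = x'.2] = orbit_tens x.2.
  apply/seteqP; split=> [_ [_ [g1 [g2 [g3 [t [? ? ? _ ->]]]]] ->]|_ [g1 [g2 [g3 [? ? ? ->]]]]].
    by exists g1, g2, g3.
  exists (act_space g1 g2 g3 1 x) => //.
  by exists g1, g2, g3, 1; rewrite oner_neq0.
split.
- move=> _ [x [Px _] <-]; rewrite fE; by exists x.2.
- move=> _ _ /set_mem [x [_ Qx] <-] /set_mem [x' [_ Qx'] <-]; rewrite !fE => e.
  rewrite zpoly_eval_P2 in Qx; rewrite zpoly_eval_P2 in Qx'.
  have : orbit_tens x.2 x'.2 by rewrite e; apply: orbit_tens_self.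
  move=> [g1 [g2 [g3 [g1U g2U g3U x'E]]]].
  (* After moving [x], the second components agree, and the normal form sees only the second
     component. *)
  rewrite -(orbit_space_act x g1U g2U g3U (oner_neq0 _)).
  have e1 := orbit_normal_form (p2_act_neq0 g1U g2U g3U (oner_neq0 _) Qx).
  by rewrite e1 (orbit_normal_form Qx') x'E.
move=> _ [z Pz <-]; have [y py] := exists_p2_neq0 Pz.
exists (orbit_space (y, z)); last by rewrite fE.
by exists (y, z) => //; split=> //; rewrite zpoly_eval_P2.
Qed.

End OrbitSpaceBijection.

(** * Automorphisms of a separable closure *)

Section Extension.
Variables (k K : fieldType) (iota : {rmorphism k -> K}).
Hypothesis Ksep : separable_closure iota.
Local Notation "p ^i" := (map_poly iota p) (at level 2, format "p ^i").

Lemma sep_root (p : {poly K}) : separable_poly p -> size p != 1%N -> exists y, root p y.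
Proof. by case: Ksep => _; apply. Qed.

Lemma sep_algebraic (y : K) : exists2 p : {poly k}, separable_poly p & root p^i y.
Proof. by case: Ksep => + _; apply. Qed.

Lemma sep_split (p : {poly K}) : separable_poly p ->
  exists rs, p = lead_coef p *: \prod_(r <- rs) ('X - r%:P).
Proof.
have [n] := ubnP (size p); elim: n p => // n IH p lepn psep.
have p0 := separable_poly_neq0 psep.
have [/eqP/size_poly1P [c c0 ->]|p1] := eqVneq (size p) 1%N.
  by exists [::]; rewrite big_nil lead_coefC -mul_polyC mulr1.
have [y /factor_theorem [q pE]] := sep_root psep p1.
have q0 : q != 0 by apply: contra_neq p0 => q0; rewrite pE q0 mul0r.
have qsep : separable_poly q by apply: dvdp_separable psep; rewrite pE dvdp_mulr.
have sq : (size q < n)%N.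
  by move: lepn; rewrite pE size_Mmonic ?monicXsubC // size_XsubC addn2.
have [rs qE] := IH q sq qsep; exists (y :: rs).
rewrite big_cons [in RHS]pE lead_coef_Mmonic ?monicXsubC // {1}pE {1}qE.
by rewrite -scalerAl [X in _ *: X]mulrC.
Qed.

Lemma sep_roots (p : {poly K}) : separable_poly p ->
  exists2 rs, uniq rs & forall y, root p y = (y \in rs).
Proof.
move=> psep; have [rs pE] := sep_split psep; exists rs.
  rewrite -separable_prod_XsubC; apply: (dvdp_separable _ psep).
  by rewrite [X in _ %| X]pE dvdpZr ?dvdpp ?lead_coef_eq0 ?separable_poly_neq0.
move=> y; rewrite pE rootZ ?lead_coef_eq0 ?separable_poly_neq0 //.
exact: root_prod_XsubC.
Qed.

(* As K is algebraic over k, such a G is the graph of an isomorphism between two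
   subfields of K. *)
Definition partial_iso (G : set (K * K)) : Prop :=
  [/\ forall a, G (iota a, iota a),
      forall u v, G u -> G v -> G (u.1 - v.1, u.2 - v.2),
      forall u v, G u -> G v -> G (u.1 * v.1, u.2 * v.2)
    & forall b, G (0, b) -> b = 0].

Section Graph.
Variable G : set (K * K).
Hypothesis isoG : partial_iso G.

Let GB u v u' v' : G (u, u') -> G (v, v') -> G (u - v, u' - v').
Proof. by case: isoG => _ h _ _ Gu Gv; apply: (h (u, u') (v, v')). Qed.
Let GM u v u' v' : G (u, u') -> G (v, v') -> G (u * v, u' * v').
Proof. by case: isoG => _ _ h _ Gu Gv; apply: (h (u, u') (v, v')). Qed.
Let Gi a : G (iota a, iota a). Proof. by case: isoG. Qed.
Let Gz b : G (0, b) -> b = 0. Proof. by case: isoG => _ _ _; apply. Qed.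
Let G0 : G (0, 0). Proof. by have := Gi 0; rewrite rmorph0. Qed.
Let G1 : G (1, 1). Proof. by have := Gi 1; rewrite rmorph1. Qed.
Let GN u u' : G (u, u') -> G (- u, - u').
Proof. by move=> Gu; have := GB G0 Gu; rewrite !sub0r. Qed.
Let GD u v u' v' : G (u, u') -> G (v, v') -> G (u + v, u' + v').
Proof. by move=> Gu Gv; have := GB Gu (GN Gv); rewrite !opprK. Qed.

Lemma partial_iso_fun u a b : G (u, a) -> G (u, b) -> a = b.
Proof.
move=> Ga Gb; have := GB Ga Gb; rewrite subrr => /Gz /eqP.
by rewrite subr_eq0 => /eqP.
Qed.

Lemma partial_iso_horner p u u' : G (u, u') -> G (p^i.[u], p^i.[u']).
Proof.
move=> Gu; elim/poly_ind: p => [|p c IH]; first by rewrite rmorph0 !horner0.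
by rewrite rmorphD rmorphM /= map_polyX map_polyC !hornerE; apply: GD (Gi c); apply: GM.
Qed.

(** Closure under inverses is automatic: dividing a relation for [u] over k by powers of X gives one
    with non-zero constant term, which expresses the inverse as a polynomial in [u]. The same
    relation holds for [u']. *)
Lemma partial_iso_inv u u' : G (u, u') -> u != 0 -> u' != 0 /\ G (u^-1, u'^-1).
Proof.
move=> Gu u0; have [p psep] := sep_algebraic u.
have := separable_poly_neq0 psep => {psep}.
elim/poly_ind: p => [|p c IH]; first by rewrite eqxx.
have [->|c0] := eqVneq c 0.
  rewrite polyC0 addr0 => pX; rewrite rmorphM /= map_polyX rootM rootX (negPf u0) orbF.
  by apply: IH; apply: contra_neq pX => ->; rewrite mul0r.
move=> _; rewrite rmorphD rmorphM /= map_polyX map_polyC /= => /rootP ru.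
have := partial_iso_horner (p * 'X + c%:P) Gu.
rewrite rmorphD rmorphM /= map_polyX map_polyC /= ru => /Gz.
move: ru; rewrite !hornerE => ru ru'.
have ic0 : iota c != 0 by rewrite fmorph_eq0.
have u0' : u' != 0.
  by apply: contra_neq ic0 => e; move: ru'; rewrite e mulr0 add0r.
split=> //.
have invE v : p^i.[v] * v + iota c = 0 -> v != 0 -> v^-1 = - p^i.[v] * iota (c^-1).
  move=> e v0; apply: (mulIf v0); rewrite mulVf // fmorphV mulrAC.
  rewrite mulNr (_ : p^i.[v] * v = - iota c) ?opprK ?mulfV //.
  by apply/eqP; rewrite -addr_eq0 e.
by rewrite !invE //; apply: GM => //; apply: GN; apply: partial_iso_horner.
Qed.

Lemma partial_iso_eq0 u u' : G (u, u') -> (u == 0) = (u' == 0).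
Proof.
move=> Gu; have [u0|u0] := eqVneq u 0; first by rewrite u0 in Gu; rewrite (Gz Gu) eqxx.
by have [/negPf -> _] := partial_iso_inv Gu u0.
Qed.

(** [f'] is the transport of [f] along the isomorphism with graph [G]. *)
Definition poly_in (f f' : {poly K}) := forall i, G (f`_i, f'`_i).

Lemma poly_in_size f f' : poly_in f f' -> size f = size f'.
Proof.
move=> ff'; apply/eqP; rewrite eqn_leq.
apply/andP; split; apply/leq_sizeP => j lej.
  by apply/eqP; rewrite (partial_iso_eq0 (ff' j)) nth_default.
by apply/eqP; rewrite -(partial_iso_eq0 (ff' j)) nth_default.
Qed.

Lemma poly_inB f f' g g' : poly_in f f' -> poly_in g g' -> poly_in (f - g) (f' - g').
Proof. by move=> ff gg i; rewrite !coefB; apply: GB. Qed.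

Lemma poly_inD f f' g g' : poly_in f f' -> poly_in g g' -> poly_in (f + g) (f' + g').
Proof. by move=> ff gg i; rewrite !coefD; apply: GD. Qed.

Lemma poly_inM f f' g g' : poly_in f f' -> poly_in g g' -> poly_in (f * g) (f' * g').
Proof.
move=> ff gg i; rewrite !coefM.
apply: (big_ind2 (fun u u' => G (u, u'))) => [//|u u' v v' Gu Gv|j _].
  exact: GD.
exact: GM.
Qed.

Lemma poly_inC u u' : G (u, u') -> poly_in u%:P u'%:P.
Proof. by move=> Gu i; rewrite !coefC; case: eqP. Qed.

Lemma poly_inXn n : poly_in 'X^n 'X^n.
Proof. by move=> i; rewrite !coefXn; case: eqP. Qed.

Lemma poly_in_map p : poly_in p^i p^i.
Proof. by move=> i; rewrite coef_map; apply: Gi. Qed.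

Definition adjoin x x' : set (K * K) :=
  [set u | exists f f', [/\ poly_in f f', u.1 = f.[x] & u.2 = f'.[x']]].

Lemma sub_adjoin x x' : G `<=` adjoin x x'.
Proof.
move=> [u u'] Gu; exists u%:P, u'%:P; rewrite !hornerC; split=> //.
exact: poly_inC.
Qed.

Lemma adjoin_gen x x' : adjoin x x' (x, x').
Proof.
exists 'X^1, 'X^1; rewrite expr1 !hornerX; split=> //.
by have := poly_inXn 1; rewrite expr1.
Qed.

(** [f] is the minimal polynomial of [x] over the domain of [G], and [f'] its transport. Division by
    [f] is carried out on both sides at once, so a relation [g] for [x] has a transport divisible by
    [f']. For a separable relation over k, its own transport, this makes [f'] separable; in general
    it makes [x |-> x'] well defined for each root [x'] of [f']. *)
Lemma minimal_relation x : exists f f', [/\ poly_in f f', f \is monic, root f x,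
   separable_poly f' & forall x', root f' x' -> partial_iso (adjoin x x')].
Proof.
pose rel n := exists f f', [/\ poly_in f f', f != 0, root f x & size f = n].
have [p psep px] := sep_algebraic x.
have ex : exists n, `[< rel n >].
  exists (size p^i); apply/asboolP; exists p^i, p^i; split=> //; first exact: poly_in_map.
  by rewrite map_poly_eq0 separable_poly_neq0.
case: (ex_minnP ex) => n /asboolP [f0 [f0' [f0G f00 f0x f0n]]] nmin {ex}.
have lG := f0G (size f0).-1; rewrite -lead_coefE in lG.
have lf0 : lead_coef f0 != 0 by rewrite lead_coef_eq0.
have [_ lVG] := partial_iso_inv lG lf0.
set l' := f0'`_(size f0).-1 in lG lVG.
pose f := (lead_coef f0)^-1%:P * f0; pose f' := l'^-1%:P * f0'.
have fG : poly_in f f' by apply: poly_inM => //; apply: poly_inC.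
have fm : f \is monic.
  by rewrite monicE lead_coefM lead_coefC mulVf.
have fx : root f x by rewrite rootM f0x orbT.
have fn : size f = n by rewrite size_Cmul ?invr_eq0.
have f'm : f' \is monic.
  have := fG (size f).-1; rewrite -lead_coefE (monicP fm) => h.
  rewrite monicE lead_coefE -(poly_in_size fG); apply/eqP.
  exact: (partial_iso_fun h G1).
have div g g' : poly_in g g' -> root g x ->
    exists q q', [/\ poly_in q q', g = q * f & g' = q' * f'].
  have [m] := ubnP (size g); elim: m g g' => // m IH g g' leg gG gx.
  have [g0|g0] := eqVneq g 0.
    exists 0, 0; split=> [i||]; rewrite ?coef0 ?mul0r //.
    by apply/eqP; rewrite -size_poly_eq0 -(poly_in_size gG) g0 size_poly0.
  have leng : (n <= size g)%N by apply: nmin; apply/asboolP; exists g, g'.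
  have cG := gG (size g).-1; rewrite -lead_coefE in cG.
  pose d := (size g - n)%N.
  pose t := (lead_coef g)%:P * 'X^d; pose t' := (g'`_(size g).-1)%:P * 'X^d.
  have tG : poly_in t t' by apply: poly_inM; [exact: poly_inC | exact: poly_inXn].
  have g1G : poly_in (g - t * f) (g' - t' * f') by apply: poly_inB => //; apply: poly_inM.
  have lt1 : (size (g - t * f)%R < m)%N.
    have n0 : (0 < n)%N by rewrite -fn size_poly_gt0 monic_neq0.
    have g0' : (0 < size g)%N by rewrite size_poly_gt0.
    have le1 : (size (g - t * f)%R <= (size g).-1)%N.
      apply/leq_sizeP => j lej.
      rewrite coefB -mulrA coefCM coefXnM ltnNge.
      have ledj : (d <= j)%N by rewrite (leq_trans _ lej) // -subn1 leq_sub2l.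
      rewrite ledj /=; have [e|lt] : j = (size g).-1 \/ (size g <= j)%N.
        by move: lej; rewrite leq_eqVlt prednK // => /orP [/eqP <-|]; [left|right].
        rewrite e -lead_coefE (_ : (_ - d)%N = (size f).-1); last first.
          by rewrite /d fn -subn1 subnAC subKn // subn1.
        by rewrite -lead_coefE (monicP fm) mulr1 subrr.
      rewrite nth_default // (nth_default 0 (s := f)) ?mulr0 ?subrr // fn.
      by rewrite leq_subRL // /d subnK // (leq_trans _ lt) ?leq_subr.
    by rewrite -ltnS (leq_trans _ leg) // ltnS (leq_ltn_trans le1) // prednK.
  have g1x : root (g - t * f) x.
    by rewrite rootE hornerD hornerN hornerM (rootP fx) mulr0 subr0; apply/eqP/rootP.
  have [q [q' [qG e e']]] := IH _ _ lt1 g1G g1x.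
  exists (q + t), (q' + t'); split; first exact: poly_inD.
    by rewrite mulrDl -e subrK.
  by rewrite mulrDl -e' subrK.
exists f, f'; split=> //.
  have [q [q' [_ _ pE]]] := div _ _ (poly_in_map p) px.
  apply: (@dvdp_separable _ p^i); first by rewrite pE dvdp_mull.
  by rewrite separable_map.
move=> x' fx'; split=> [a|u v|u v|b].
- by apply: sub_adjoin; apply: Gi.
- move=> [g [g' [gG -> ->]]] [h [h' [hG -> ->]]]; exists (g - h), (g' - h').
  by split; rewrite ?hornerD ?hornerN //; apply: poly_inB.
- move=> [g [g' [gG -> ->]]] [h [h' [hG -> ->]]]; exists (g * h), (g' * h').
  by split; rewrite ?hornerM //; apply: poly_inM.
move=> [g [g' [gG /= /esym/rootP gx ->]]].
have [q [q' [_ _ ->]]] := div _ _ gG gx.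
by rewrite hornerM (rootP fx') mulr0.
Qed.

End Graph.

Lemma exists_rmorphism (s : K -> K) :
  (forall x y, s (x - y) = s x - s y) -> (forall x y, s (x * y) = s x * s y) -> s 1 = 1 ->
  exists h : {rmorphism K -> K}, h =1 s.
Proof.
move=> sB sM s1.
pose A := GRing.isZmodMorphism.Build K K s sB.
pose M := GRing.isMonoidMorphism.Build K K s (s1, sM).
pose h : {rmorphism K -> K} := HB.pack s A M.
by exists h.
Qed.

(** An injective map that preserves the finite set of roots of a polynomial over k permutes it, and
    every [y] lies in such a set. *)
Lemma rmorphism_bij (s : {rmorphism K -> K}) :
  (forall a, s (iota a) = iota a) -> bijective s.
Proof.
move=> si; have surj y : exists x, s x = y.
  have [p psep py] := sep_algebraic y.
  have [|rs rsu rsE] := @sep_roots p^i; first by rewrite separable_map.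
  have smap x : x \in rs -> s x \in rs.
    rewrite -!rsE => /rootP px; apply/rootP.
    have e : map_poly s p^i = p^i.
      by rewrite -map_poly_comp; apply: eq_map_poly => a; rewrite /= si.
    by rewrite -e horner_map px rmorph0.
  have sub : {subset map s rs <= rs} by move=> _ /mapP [x xrs ->]; apply: smap.
  have su : uniq (map s rs) by rewrite map_inj_uniq //; apply: fmorph_inj.
  have [_ eqs] := uniq_min_size su sub (eq_leq (esym (size_map s rs))).
  have : y \in map s rs by rewrite eqs -rsE.
  by move=> /mapP [x _ ->]; exists x.
pose g y := projT1 (cid (surj y)).
have gK : cancel g s by move=> y; rewrite /g; case: cid.
by exists g => //; apply: inj_can_sym gK (fmorph_inj s).
Qed.

Lemma extend_partial_iso (G : set (K * K)) : partial_iso G ->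
  exists s : gal iota, forall u, G u -> s u.1 = u.2.
Proof.
move=> isoG.
pose P (H : set (K * K)) := H = set0 \/ (partial_iso H /\ G `<=` H).
have [|M [PM Mmax]] := @Zorn_bigcup _ P.
  move=> F FP tot.
  have [[H0 [FH0 H0n0]]|none] := pselect (exists H, F H /\ H !=set0); last first.
    left; apply/seteqP; split=> // u [H FH Hu]; apply: none.
    by exists H; split=> //; exists u.
  have good H : F H -> H !=set0 -> partial_iso H /\ G `<=` H.
    by move=> FH Hn; case: (FP H FH) => // He; move: Hn; rewrite He => [[]].
  have [iso0 GH0] := good _ FH0 H0n0.
  right; split; last by move=> u Gu; exists H0 => //; apply: GH0.
  have common u v : (\bigcup_(X in F) X) u -> (\bigcup_(X in F) X) v ->
      exists H, [/\ F H, partial_iso H, H u & H v].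
    move=> [H1 F1 u1] [H2 F2 v2].
    by case: (tot _ _ F1 F2) => sub; [exists H2|exists H1]; split=> //;
      try exact: sub; apply: (good _ _ _).1 => //; [exists v|exists u].
  split=> [a|u v Uu Uv|u v Uu Uv|b [H FH Hb]].
  - by exists H0 => //; case: iso0.
  - by have [H [FH [_ HB _ _] Hu Hv]] := common u v Uu Uv; exists H => //; apply: HB.
  - by have [H [FH [_ _ HM _] Hu Hv]] := common u v Uu Uv; exists H => //; apply: HM.
  by have [|[_ _ _ Hz] _] := good H FH; [exists (0, b)|exact: Hz].
have G0 : G (iota 0, iota 0) by case: isoG.
have [isoM GM] : partial_iso M /\ G `<=` M.
  case: PM => // M0; case: (Mmax G); last by right; split.
  by rewrite M0; split=> [u []|/(_ _ G0)].
have tot x : exists x', M (x, x').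
  have [f [f' [fM fm fx f'sep adjP]]] := minimal_relation isoM x.
  have [x' fx'] : exists x', root f' x'.
    apply: sep_root => //; rewrite -(poly_in_size isoM fM); apply/eqP => s1.
    have /size_poly1P [c c0 fE] : size f == 1%N by rewrite s1.
    by move: fx; rewrite fE rootC (negPf c0).
  have iso' := adjP _ fx'; exists x'.
  apply: contrapT => nM; apply: (Mmax (adjoin M x x')); last first.
    by right; split=> // u Gu; apply: (sub_adjoin isoM); apply: GM.
  split; last by move=> e; apply: nM; apply: e; apply: (adjoin_gen isoM).
  exact: (sub_adjoin isoM).
pose s x := projT1 (cid (tot x)).
have sP x : M (x, s x) by rewrite /s; case: cid.
have sE u : M u -> s u.1 = u.2.
  by case: u => u u' Mu; apply: (partial_iso_fun isoM (sP u) Mu).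
have [Mi MB MM _] := isoM.
have [h hE] : exists h : {rmorphism K -> K}, h =1 s.
  apply: exists_rmorphism => [x y|x y|].
  - exact: (sE _ (MB _ _ (sP x) (sP y))).
  - exact: (sE _ (MM _ _ (sP x) (sP y))).
  by have := sE _ (Mi 1); rewrite /= rmorph1.
have hi a : h (iota a) = iota a by rewrite hE (sE _ (Mi a)).
exists (Gal (rmorphism_bij hi) hi) => u Gu /=; rewrite hE; apply: sE; exact: GM.
Qed.

(** If the minimal polynomial of [y] over k had degree above 1, separability would give a second
    root, and the k-isomorphism sending [y] to it would extend to an automorphism moving [y]. *)
Theorem gal_fixed (y : K) : (forall s : gal iota, s y = y) -> exists a, y = iota a.
Proof.
move=> fixy.
pose G0 : set (K * K) := [set u | exists a, u = (iota a, iota a)].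
have isoG0 : partial_iso G0.
  split=> [a|_ _ [a ->] [b ->]|_ _ [a ->] [b ->]|_ [a [<- ->]]] //; first by exists a.
    by exists (a - b); rewrite rmorphB.
  by exists (a * b); rewrite rmorphM.
have [f [f' [fG fm fy f'sep adjP]]] := minimal_relation isoG0 y.
have ff' : f = f' by apply/polyP => i; have [a [-> ->]] := fG i.
rewrite -ff' in f'sep adjP.
have [g fE] := factor_theorem _ _ fy.
have [g1|g1] := eqVneq (size g) 1%N.
  have g_1 : g = 1.
    have /size_poly1P [c c0 gE] : size g == 1%N by rewrite g1.
    move: fm; rewrite fE gE monicE lead_coefM lead_coefC lead_coefXsubC mulr1 => /eqP ->.
    by rewrite polyC1.
  have [a [e _]] := fG 0%N; exists (- a).
  by rewrite rmorphN -e fE g_1 mul1r coefB coefX coefC /= sub0r opprK.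
have gsep : separable_poly g by apply: dvdp_separable f'sep; rewrite fE dvdp_mulr.
have [y' gy'] := sep_root gsep g1.
have fy' : root f y' by rewrite fE rootM gy'.
have [s sE] := extend_partial_iso (adjP y' fy').
have := sE (y, y') (adjoin_gen isoG0 y y'); rewrite /= fixy => yy'.
by move: f'sep; rewrite fE separable_root yy' gy' andbF.
Qed.

End Extension.

(** * Galois descent *)

(** The classical shortening argument: twisting by an [e1] that separates two characters and
    subtracting removes a term. It uses only values on a multiplicative set [E], so characters
    distinct on [E] are independent on [E]. *)
Lemma dedekind_independence (K : fieldType) (I : finType) (chi : I -> {rmorphism K -> K})
    (E : set K) (P : pred I) (a : I -> K) :
  E 1 -> (forall e e', E e -> E e' -> E (e * e')) ->
  (forall i j, P i -> P j -> i != j -> exists2 e, E e & chi i e != chi j e) ->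
  (forall e, E e -> \sum_(i | P i) a i * chi i e = 0) ->
  forall i, P i -> a i = 0.
Proof.
move=> E1 EM Pdist; have [n] := ubnP #|[pred i | P i & a i != 0]|.
elim: n a => // n IH a; rewrite ltnS => lea suma i0 Pi0; apply/eqP; apply/negP => /negP a0.
have [i1 [Pi1 ne1 a1]] : exists i1, [/\ P i1, i1 != i0 & a i1 != 0].
  apply: contrapT => none; move: (suma 1 E1); rewrite (bigD1 i0) //= big1 => [|i /andP [Pi nei]].
    by rewrite addr0 rmorph1 mulr1 => /eqP; rewrite (negPf a0).
  have [->|ai] := eqVneq (a i) 0; first by rewrite mul0r.
  by case: none; exists i.
have [e1 Ee1 ne] := Pdist _ _ Pi1 Pi0 ne1.
pose b i := a i * (chi i e1 - chi i0 e1).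
have /eqP : b i1 = 0.
  apply: (IH b) => // [|e Ee].
    apply: leq_trans lea; apply: proper_card; apply/properP; split.
      apply/fintype.subsetP => i; rewrite !inE => /andP [-> /=]; apply: contra_neq => ai.
      by rewrite /b ai mul0r.
    by exists i0; rewrite !inE ?Pi0 ?a0 // /b subrr mulr0 eqxx andbF.
  transitivity (\sum_(i | P i) a i * chi i (e * e1) - chi i0 e1 * \sum_(i | P i) a i * chi i e).
    rewrite big_distrr -sumrB; apply: eq_bigr => i _ /=.
    by rewrite rmorphM /b; ring.
  by rewrite !suma ?mulr0 ?subrr //; apply: EM.
by rewrite mulf_eq0 (negPf a1) subr_eq0 (negPf ne).
Qed.

Section Descent.
Variables (k K : fieldType) (iota : {rmorphism k -> K}).
Hypothesis Ksep : separable_closure iota.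
Local Notation gal := (gal iota).

Lemma gal_inverse (s : gal) : exists t : gal, cancel s t /\ cancel t s.
Proof.
have [t sK tK] := gal_bij s.
have [h hE] : exists h : {rmorphism K -> K}, h =1 t.
  apply: exists_rmorphism => [x y|x y|].
  - by apply: (can_inj sK); rewrite rmorphB !tK.
  - by apply: (can_inj sK); rewrite rmorphM !tK.
  by apply: (can_inj sK); rewrite rmorph1 tK.
have hi a : h (iota a) = iota a by rewrite hE -{1}(gal_fix s a) sK.
have hK : cancel s h by move=> x; rewrite hE.
have Kh : cancel h s by move=> x; rewrite hE.
by exists (Gal (Bijective Kh hK) hi).
Qed.

Lemma exists_gal_id : exists s : gal, s =1 id.
Proof.
have [h hE] : exists h : {rmorphism K -> K}, h =1 id by exact: exists_rmorphism.
have hb : bijective h by exists id => x; rewrite hE.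
have hi a : h (iota a) = iota a by rewrite hE.
by exists (Gal hb hi).
Qed.

Lemma gal_stable (X : seq K) : exists2 Y : seq K, {subset X <= Y} &
  forall (s : gal) y, y \in Y -> s y \in Y.
Proof.
elim: X => [|x X [Y XY sY]]; first by exists [::].
have [p psep px] := sep_algebraic Ksep x.
have [|rs _ rsE] := @sep_roots _ _ _ Ksep (map_poly iota p); first by rewrite separable_map.
exists (rs ++ Y) => [y|s y].
  rewrite inE mem_cat => /orP [/eqP ->|/XY ->]; last by rewrite orbT.
  by rewrite -rsE px.
rewrite !mem_cat => /orP [yrs|/sY -> ]; last by rewrite orbT.
rewrite -rsE in yrs; rewrite -rsE; apply/orP; left; apply/rootP.
have e : map_poly s (map_poly iota p) = map_poly iota p.
  by rewrite -map_poly_comp; apply: eq_map_poly => a; rewrite /= gal_fix.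
by rewrite -e horner_map (rootP yrs) rmorph0.
Qed.

Variable phi : gal -> 'S_3.
Hypothesis phiP : gal_hom phi.

Definition equivariant (l : 'I_3 -> K) := forall (s : gal) i, s (l i) = l (phi s i).

(** Continuity is given at the identity; composing with the inverse of [s] carries it to every
    automorphism. *)
Lemma gal_hom_agree : exists X : seq K, forall s t : gal,
  {in X, s =1 t} -> phi s = phi t.
Proof.
have [phiM [X phiX]] := phiP; exists X => s t st.
have [u [su us]] := gal_inverse s.
have eM (w : gal) i : (forall y, y \in X -> u (w y) = y) -> phi u (phi w i) = i.
  by move=> uw; rewrite -phiM phiX ?perm1.
apply/permP => i; apply: (@perm_inj _ (phi u)).
by rewrite !eM // => y yX; rewrite -?st ?su.
Qed.

Lemma gal_hom_id (s : gal) : s =1 id -> phi s = 1%g.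
Proof. by move=> s1; have [_ [X phiX]] := phiP; apply: phiX => y _; rewrite s1. Qed.

(* Let Y be finite, Galois-stable and such that s|Y determines phi s, and let E be
   the subfield where s|Y determines s. For e in E and fixed j, the vector
   l i = \sum_(f | phi f j = i) f e, with f running over the restrictions to Y, is
   equivariant; a relation between all of these is one between characters of E. *)
Theorem equivariant_span (c : 'I_3 -> K) :
  (forall l, equivariant l -> \sum_i c i * l i = 0) -> forall i, c i = 0.
Proof.
move=> cl j; have [X phiX] := gal_hom_agree; have [Y XY sY] := gal_stable X.
have phiY (s t : gal) : {in Y, s =1 t} -> phi s = phi t.
  by move=> st; apply: phiX => y /XY; apply: st.
pose T := {ffun seq_sub Y -> seq_sub Y}.
pose res (s : gal) : T := [ffun y => SeqSub (sY s _ (valP y))].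
have resP (s t : gal) : res s = res t <-> {in Y, s =1 t}.
  split=> [/ffunP e y yY|e].
    by have := e (SeqSub yY); rewrite !ffunE => /(congr1 val).
  by apply/ffunP => y; rewrite !ffunE; apply: val_inj; apply: e; apply: valP.
pose im (f : T) := `[< exists s, res s = f >].
have [id1 id1P] := exists_gal_id.
(* A chosen lift of a restriction to [Y]; [id1] is the default for maps that are not
   restrictions. *)
pose rep (f : T) : gal := if pselect (exists s, res s = f) is left e then projT1 (cid e) else id1.
have repP f : im f -> res (rep f) = f.
  by move=> /asboolP ex; rewrite /rep; case: pselect => // e; case: cid.
have im_res s : im (res s) by apply/asboolP; exists s.
pose E : set K := [set e | forall s t : gal, {in Y, s =1 t} -> s e = t e].
have E1 : E 1 by move=> s t _; rewrite !rmorph1.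
have EM e e' : E e -> E e' -> E (e * e').
  by move=> Ee Ee' s t st; rewrite !rmorphM (Ee s t st) (Ee' s t st).
have YE y : y \in Y -> E y by move=> yY s t; apply.
pose l e i := \sum_(f | im f && (phi (rep f) j == i)) rep f e.
have leq e : E e -> equivariant (l e).
  move=> Ee s i; rewrite /l rmorph_sum.
  (* Composition with [s] permutes the restrictions, and reindexing by it yields equivariance. *)
  pose tau (f : T) : T := [ffun y => res s (f y)].
  have tauE (t : gal) : tau (res t) = res (gal_comp s t).
    by apply/ffunP => y; rewrite !ffunE; apply: val_inj.
  have tau_inj : injective tau.
    move=> f f' /ffunP e'; apply/ffunP => y; have := e' y; rewrite !ffunE.
    by move=> /(congr1 val) /= /fmorph_inj/val_inj.
  have im_tau f : im (tau f) = im f.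
    apply/idP/idP => [/asboolP [t tE]|/repP <-]; last by rewrite tauE.
    have [u [su us]] := gal_inverse s; apply/asboolP; exists (gal_comp u t).
    apply: tau_inj; rewrite tauE -tE; apply/resP => y _ /=; exact: us.
  rewrite [RHS](reindex_inj tau_inj) /=.
  have repE f : im f -> {in Y, rep (tau f) =1 gal_comp s (rep f)}.
    by move=> imf; apply/resP; rewrite repP ?im_tau // -tauE repP.
  apply: eq_big => [f|f /andP [imf _]].
    rewrite im_tau; have [imf|//] := boolP (im f); rewrite (phiY _ _ (repE f imf)) /=.
    by have [phiM _] := phiP; rewrite phiM (inj_eq perm_inj).
  by rewrite (Ee _ _ (repE f imf)).
have sumE e : \sum_i c i * l e i = \sum_(f | im f) c (phi (rep f) j) * rep f e.
  rewrite (partition_big (fun f => phi (rep f) j) xpredT) //=.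
  apply: eq_bigr => i _; rewrite big_distrr; apply: eq_bigr => f /andP [_ /eqP ->] //.
have ded := @dedekind_independence _ _ (fun f => gal_fun (rep f)) E im
  (fun f => c (phi (rep f) j)) E1 EM.
have c0 f : im f -> c (phi (rep f) j) = 0.
  apply: ded f => [f f' imf imf' ne|e Ee]; last by rewrite -sumE; apply/cl/leq.
  apply: contrapT => none; case/eqP: ne; rewrite -(repP _ imf) -(repP _ imf').
  apply/resP => y yY; apply: contrapT => ney; apply: none; exists y; first exact: YE.
  exact/eqP.
(* At the restriction of the identity the coefficient is [c j] itself. *)
have := c0 _ (im_res id1); rewrite (phiY _ id1); last first.
  by apply/resP; rewrite repP.
by rewrite gal_hom_id ?perm1.
Qed.

End Descent.

(** * Zeros of binary cubic forms *)

Section Points.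
Variable K : fieldType.
Implicit Types v w : 'cV[K]_2.

Lemma same_point_refl v : same_point v v.
Proof. by exists 1; rewrite ?scale1r ?oner_neq0. Qed.

Lemma same_point_sym v w : same_point v w -> same_point w v.
Proof.
by move=> [c c0 ->]; exists c^-1; rewrite ?invr_eq0 // scalerA mulVf // scale1r.
Qed.

Lemma same_point_trans u v w : same_point u v -> same_point v w -> same_point u w.
Proof. by move=> [c c0 ->] [d d0 ->]; exists (c * d); rewrite ?mulf_neq0 // scalerA. Qed.

Lemma same_point_map (s : {rmorphism K -> K}) v w :
  same_point v w -> same_point (map_mx s v) (map_mx s w).
Proof. by move=> [c c0 ->]; exists (s c); rewrite ?fmorph_eq0 // map_mxZ. Qed.

Lemma same_point_mulmx (g : 'M[K]_2) v w : same_point v w -> same_point (g *m v) (g *m w).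
Proof. by move=> [c c0 ->]; exists c => //; rewrite -scalemxAr. Qed.

Lemma same_point_wedge v w : v != 0 -> w != 0 ->
  same_point v w <-> wedge [:: v; w] = 0.
Proof.
move=> v0 w0; rewrite wedge22E; split=> [[c _ ->]|]; first by rewrite !mxE; ring.
move=> e; have [w00|w00] := eqVneq (w 0 0) 0.
  have w10 : w 1 0 != 0.
    by apply: contra_neq w0 => w10; apply/colP; elim/ord2P; rewrite mxE.
  have v00 : v 0 0 = 0.
    by apply: (mulIf w10); move: e; rewrite w00 mul0r subr0 mul0r.
  exists (v 1 0 / w 1 0).
    rewrite mulf_neq0 ?invr_eq0 //; apply: contra_neq v0 => v10.
    by apply/colP; elim/ord2P; rewrite mxE.
  apply/colP; elim/ord2P; rewrite mxE ?v00 ?w00 ?mulr0 //.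
  by rewrite divfK.
have eV : v = (v 0 0 / w 0 0) *: w.
  apply/colP; elim/ord2P; rewrite mxE ?divfK //.
  apply: (mulIf w00); rewrite mulrAC divfK //.
  by apply/eqP; rewrite eq_sym -subr_eq0 [v 1 0 * _]mulrC e.
exists (v 0 0 / w 0 0) => //; apply: contra_neq v0 => e0.
by rewrite eV e0 scale0r.
Qed.

(** A representative of the projective point that commutes with field automorphisms: its first
    non-zero coordinate is 1. *)
Definition normalize v : 'cV[K]_2 :=
  if v 0 0 != 0 then (v 0 0)^-1 *: v else (v 1 0)^-1 *: v.

Lemma normalize_same v : v != 0 -> same_point (normalize v) v.
Proof.
move=> v0; rewrite /normalize; case: ifPn => [v00|/negPn/eqP v00].
  by exists (v 0 0)^-1; rewrite ?invr_eq0.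
exists (v 1 0)^-1 => //; rewrite invr_eq0; apply: contra_neq v0 => v10.
by apply/colP; elim/ord2P; rewrite mxE.
Qed.

Lemma normalize_eq v w : same_point v w -> normalize v = normalize w.
Proof.
move=> [c c0 ->]; rewrite /normalize !mxE mulf_eq0 (negPf c0) /=.
by case: ifP => _; rewrite scalerA invfM mulrAC mulVf // mul1r.
Qed.

Lemma map_normalize (s : {rmorphism K -> K}) v :
  map_mx s (normalize v) = normalize (map_mx s v).
Proof.
by rewrite /normalize mxE fmorph_eq0; case: ifP => _; rewrite map_mxZ fmorphV ?mxE.
Qed.

Lemma same_point_neq0 v w : same_point v w -> (v == 0) = (w == 0).
Proof. by move=> [c c0 ->]; rewrite scaler_eq0 (negPf c0). Qed.

End Points.

Section CubicRoots.
Variable K : fieldType.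
Implicit Types (c : nat -> K) (v w : 'cV[K]_2).

Lemma binary_cubicZ c a v : binary_cubic c (a *: v) = a ^+ 3 * binary_cubic c v.
Proof. by rewrite /binary_cubic !mxE; ring. Qed.

Lemma cubic_subst_mul (h g : 'M[K]_2) c n :
  cubic_subst h (cubic_subst g c) n = cubic_subst (h *m g) c n.
Proof.
have e i j : (h *m g) i j = h i 0 * g 0 j + h i 1 * g 1 j by rewrite mxE sum2E.
by case: n => [|[|[|n]]]; rewrite /cubic_subst !e; ring.
Qed.

Lemma cubic_subst1 c n : (n < 4)%N -> cubic_subst 1%:M c n = c n.
Proof. by case: n => [|[|[|[|//]]]] _; rewrite /cubic_subst !mxE /=; ring. Qed.

Lemma eq_cubic_subst (g : 'M[K]_2) c c' n : (forall i, (i < 4)%N -> c i = c' i) ->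
  cubic_subst g c n = cubic_subst g c' n.
Proof. by move=> e; case: n => [|[|[|n]]]; rewrite /cubic_subst !e. Qed.

(* In the basis [r 0], [r 1] the form is [v0 v1 (A v0 + B v1)], and [r 2]
   determines [A : B]. *)
Lemma cubic_three_roots (r : 'I_3 -> 'cV[K]_2) :
  (forall i j, i != j -> wedge [:: r i; r j] != 0) ->
  exists G, forall c, (forall i, binary_cubic c (r i) = 0) ->
    exists mu, forall n, (n < 4)%N -> c n = mu * G n.
Proof.
move=> rw; pose g : 'M[K]_2 := \matrix_(i, j) (if i == 0 then r 0 else r 1) j 0.
have gU : g \in unitmx.
  rewrite unitmxE unitfE det2E !mxE /=.
  by rewrite (_ : _ - _ = wedge [:: r 0; r 1]) ?rw // wedge22E; ring.
have g0 : g^T *m basis K 0 = r 0 by rewrite /basis -colE; apply/colP => i; rewrite !mxE.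
have g1 : g^T *m basis K 1 = r 1 by rewrite /basis -colE; apply/colP => i; rewrite !mxE.
pose w := (invmx g)^T *m r 2.
have gw : g^T *m w = r 2 by rewrite /w mulmxA -trmx_mul mulVmx // trmx1 mul1mx.
have gwE : r 2 = w 0 0 *: r 0 + w 1 0 *: r 1.
  by rewrite -gw; apply/colP => i; rewrite mxE sum2E !mxE /=; ring.
have w00 : w 0 0 != 0.
  have := rw 2 1 isT; apply: contra_neq => w0; rewrite gwE w0 wedge22E !mxE; ring.
have w10 : w 1 0 != 0.
  have := rw 2 0 isT; apply: contra_neq => w0; rewrite gwE w0 wedge22E !mxE; ring.
(* The form [v0 v1 (w1 v0 - w0 v1)], whose third zero is [w], the third point in the new basis. *)
pose G' n := match n with 1 => w 1 0 | 2 => - w 0 0 | _ => 0 end.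
exists (cubic_subst (invmx g) G') => c cr; pose c' := cubic_subst g c.
have c'E v : binary_cubic c' v = binary_cubic c (g^T *m v) by rewrite binary_cubic_subst.
have c'0 : c' 0%N = 0.
  by have := c'E (basis K 0); rewrite g0 cr /binary_cubic !mxE /= => <-; ring.
have c'3 : c' 3%N = 0.
  by have := c'E (basis K 1); rewrite g1 cr /binary_cubic !mxE /= => <-; ring.
have c'12 : c' 1%N * w 0 0 + c' 2%N * w 1 0 = 0.
  apply: (mulIf (mulf_neq0 w00 w10)); rewrite mul0r.
  by have := c'E w; rewrite gw cr /binary_cubic c'0 c'3 => e; rewrite -[RHS]e; ring.
exists (c' 1%N / w 1 0) => n ltn.
rewrite -[LHS]cubic_subst1 // -(mulVmx gU) -cubic_subst_mul.
transitivity (cubic_subst (invmx g) (fun n => c' 1%N / w 1 0 * G' n) n).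
  apply: eq_cubic_subst => i lti; rewrite -[LHS]/(c' i).
  case: i lti => [|[|[|[|//]]]] _; rewrite ?c'0 ?c'3 /G' ?mulr0 //; first by rewrite divfK.
  apply: (mulIf w10); rewrite mulrN mulNr mulrAC divfK //.
  by apply/eqP; rewrite -addr_eq0 addrC c'12.
by case: n ltn => [|[|[|[|//]]]] _; rewrite /cubic_subst; ring.
Qed.

End CubicRoots.

Section Roots.
Variables (k K : fieldType) (iota : {rmorphism k -> K}).
Hypothesis Ksep : separable_closure iota.

(** [u] and [v] are the resultant cofactors of [f] and its derivative with a factor [c 0] removed.
    Their combination is minus the discriminant in every characteristic, also when [c 0]
    vanishes. *)
Lemma disc_separable (c : nat -> K) : cubic_disc c != 0 ->
  separable_poly ((c 0%N)%:P * 'X^3 + (c 1%N)%:P * 'X^2 + (c 2%N)%:P * 'X + (c 3%N)%:P).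
Proof.
set f := _ + _ => d0; rewrite unlock.
have df : f^`() = (3 * c 0%N)%:P * 'X^2 + (2 * c 1%N)%:P * 'X + (c 2%N)%:P.
  rewrite /f !derivD !deriv_mulC !derivXn derivX derivC addr0 mulr1 /=.
  by rewrite !polyCM !polyC_natr; ring.
pose a := (c 0%N)%:P; pose b := (c 1%N)%:P; pose g := (c 2%N)%:P; pose d := (c 3%N)%:P.
pose u := (6 * a * b ^+ 2 - 18 * a ^+ 2 * g) * 'X
  + (27 * a ^+ 2 * d - 15 * a * b * g + 4 * b ^+ 3).
pose v := (6 * a ^+ 2 * g - 2 * a * b ^+ 2) * 'X^2
  + (7 * a * b * g - 9 * a ^+ 2 * d - 2 * b ^+ 3) * 'X
  + (4 * a * g ^+ 2 - 3 * a * b * d - b ^+ 2 * g).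
apply/Bezout_coprimepP; exists (u, v) => /=.
have -> : u * f + v * f^`() = (- cubic_disc c)%:P.
  rewrite df /u /v /f /cubic_disc.
  by rewrite !(polyC_natr, polyC_exp, polyCN, polyCB, polyCD, polyCM) -/a -/b -/g -/d; ring.
by rewrite polyC_eqp1 oppr_eq0.
Qed.

Lemma exists_cubic_roots (c : nat -> K) : cubic_disc c != 0 ->
  exists r : 'I_3 -> 'cV[K]_2, [/\ forall i, r i != 0,
    forall i j, same_point (r i) (r j) -> i = j &
    forall v, v != 0 -> (binary_cubic c v = 0 <-> exists i, same_point v (r i))].
Proof.
move=> d0; have := disc_separable d0; set f := _ + _ => fsep.
pose pt (t : K) : 'cV[K]_2 := \col_i (if i == 0 then t else 1).
have ptE t : binary_cubic c (pt t) = f.[t].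
  by rewrite /f !hornerE /binary_cubic !mxE /=; ring.
have pt_inj t t' : same_point (pt t) (pt t') -> t = t'.
  move=> [a _ e]; have := congr1 (fun u : 'cV_2 => u 1 0) e.
  have := congr1 (fun u : 'cV_2 => u 0 0) e; rewrite !mxE /= mulr1 => -> <-.
  by rewrite mul1r.
have pt0 t : pt t != 0 by apply/cV0Pn; exists 1; rewrite mxE oner_neq0.
have v_pt (v : 'cV[K]_2) : v 1 0 != 0 -> same_point v (pt (v 0 0 / v 1 0)).
  move=> v1; exists (v 1 0) => //; apply/colP; elim/ord2P; rewrite !mxE /= ?mulr1 //.
  by rewrite mulrC divfK.
have [rs fE] := sep_split Ksep fsep; have f0 := separable_poly_neq0 fsep.
have urs : uniq rs.
  rewrite -separable_prod_XsubC; apply: (dvdp_separable _ fsep).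
  by rewrite [X in _ %| X]fE dvdpZr ?dvdpp ?lead_coef_eq0.
have frs t : root f t = (t \in rs).
  by rewrite fE rootZ ?lead_coef_eq0 // root_prod_XsubC.
have sf : size f = (size rs).+1.
  by rewrite {1}fE size_scale ?lead_coef_eq0 // size_prod_XsubC.
have fPoly : f = Poly [:: c 3%N; c 2%N; c 1%N; c 0%N].
  by rewrite /= !cons_poly_def /f; ring.
pose inf : 'cV[K]_2 := basis K 0.
have inf0 : inf != 0 by apply/cV0Pn; exists 0; rewrite mxE oner_neq0.
have Finf (v : 'cV[K]_2) : v 1 0 = 0 -> binary_cubic c v = c 0%N * v 0 0 ^+ 3.
  by move=> v1; rewrite /binary_cubic v1; ring.
have inf_pt t : ~ same_point inf (pt t).
  move=> [a a0 e]; have := congr1 (fun u : 'cV_2 => u 1 0) e.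
  by rewrite !mxE /= mulr1 => a0'; rewrite -a0' eqxx in a0.
have pt_inf t : ~ same_point (pt t) inf by move/same_point_sym; apply: inf_pt.
have v_inf (v : 'cV[K]_2) : v != 0 -> v 1 0 = 0 -> same_point v inf /\ v 0 0 != 0.
  move=> v0 v1; have v00 : v 0 0 != 0.
    by apply: contra_neq v0 => v00; apply/colP; elim/ord2P; rewrite mxE.
  split=> //; exists (v 0 0) => //.
  by apply/colP; elim/ord2P; rewrite !mxE /= ?v1 ?mulr1 ?mulr0.
have Fpt (v : 'cV[K]_2) : v 1 0 != 0 -> binary_cubic c v = 0 <-> (v 0 0 / v 1 0 \in rs).
  move=> v1; rewrite -frs; have [a a0 {1}->] := v_pt _ v1; rewrite binary_cubicZ ptE rootE.
  split=> [/eqP|/eqP ->]; last by rewrite mulr0.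
  by rewrite mulf_eq0 expf_eq0 (negPf a0).
have [c0|c0] := eqVneq (c 0%N) 0; last first.
  have srs : size rs = 3%N.
    by apply: succn_inj; rewrite -sf fPoly (@PolyK _ 0).
  exists (fun i => pt rs`_i); split=> // [i j /pt_inj/eqP|v v0].
    by rewrite nth_uniq ?srs // => /eqP/val_inj.
  have [v1|v1] := eqVneq (v 1 0) 0.
    have [vi v00] := v_inf _ v0 v1; rewrite Finf //.
    split=> [/eqP|[i vp]]; first by rewrite mulf_eq0 expf_eq0 (negPf c0) (negPf v00).
    by case: (inf_pt rs`_i); apply: same_point_trans (same_point_sym vi) vp.
  rewrite Fpt //; split=> [vrs|[i vp]].
    have lti : (index (v 0%R 0%R / v 1%R 0%R) rs < 3)%N by move: vrs; rewrite -index_mem srs.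
    by exists (Ordinal lti); rewrite /= nth_index //; apply: v_pt.
  have /pt_inj -> := same_point_trans (same_point_sym (v_pt _ v1)) vp.
  by rewrite mem_nth // srs.
(* The point at infinity is now a zero. It is a simple one, so the affine polynomial has degree
   exactly 2. *)
have c1 : c 1%N != 0.
  by apply: contra_neq d0 => c1; rewrite /cubic_disc c0 c1; ring.
have srs : size rs = 2%N.
  apply: succn_inj; rewrite -sf.
  have -> : f = Poly [:: c 3%N; c 2%N; c 1%N].
    by rewrite fPoly /= !cons_poly_def c0 polyC0; ring.
  by rewrite (@PolyK _ 0).
exists (fun i => nth inf (inf :: map pt rs) i); split=> [[[|i] lti] //=|i j|v v0].
- have [le|lt] := leqP (size rs) i; first by rewrite nth_default ?size_map.
  by rewrite (nth_map 0).
- case: i j => [[|i] lti] [[|j] ltj] /=; first by move=> _; apply: val_inj.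
  + by rewrite (nth_map 0) ?srs // => /inf_pt.
  + by rewrite (nth_map 0) ?srs // => /pt_inf.
  rewrite !(nth_map 0) ?srs // => /pt_inj/eqP; rewrite nth_uniq ?srs // => /eqP e.
  by apply: val_inj; rewrite /= e.
have [v1|v1] := eqVneq (v 1 0) 0.
  have [vi v00] := v_inf _ v0 v1; rewrite Finf // c0 mul0r; split=> // _.
  by exists 0.
rewrite Fpt //; split=> [vrs|[[[|i] lti] /= vp]].
- have lti : ((index (v 0%R 0%R / v 1%R 0%R) rs).+1 < 3)%N by move: vrs; rewrite -index_mem srs.
  exists (Ordinal lti); rewrite /= (nth_map 0) ?index_mem // nth_index //; exact: v_pt.
- by case: (pt_inf (v 0 0 / v 1 0)); apply: same_point_trans vp; apply/same_point_sym/v_pt.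
rewrite (nth_map 0) ?srs // in vp.
have /pt_inj -> := same_point_trans (same_point_sym (v_pt _ v1)) vp.
by rewrite mem_nth // srs.
Qed.

Lemma cubic_form_mapE (x : tens332 k) v :
  cubic_form (map_tens iota x) v = binary_cubic (fun n => iota (cubic_coef x n)) v.
Proof. by rewrite cubic_formE /binary_cubic !map_cubic_coef. Qed.

Lemma cubic_disc_map (c : nat -> k) : cubic_disc (fun n => iota (c n)) = iota (cubic_disc c).
Proof.
by rewrite /cubic_disc !(rmorph_nat, rmorphXn, rmorphM, rmorphB, rmorphD).
Qed.

Theorem exists_root_enum (x : tens332 k) : P1 x != 0 -> exists r, root_enum iota x r.
Proof.
rewrite P1E => d0.
have [|r [r0 rinj rF]] := @exists_cubic_roots (fun n => iota (cubic_coef x n)).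
  by rewrite cubic_disc_map fmorph_eq0.
by exists r; split=> // v v0; rewrite cubic_form_mapE; apply: rF.
Qed.

End Roots.

(** Every permutation of Z/3 is affine: even ones are translations, odd ones reflections. *)
Lemma perm3_cases (p : 'S_3) i :
  (p (i + 1) = p i + 1 /\ p (i + 2) = p i + 2) \/
  (p (i + 1) = p i + 2 /\ p (i + 2) = p i + 1).
Proof.
have ne (j : 'I_3) : [/\ j + 1 != j, j + 2 != j & j + 1 != j + 2] by elim/ord3P: j.
have [n01 n02 n12] : [/\ p (i + 1) != p i, p (i + 2) != p i & p (i + 1) != p (i + 2)].
  by rewrite !(inj_eq perm_inj); apply: ne.
move: n01 n02 n12; move: (p i) (p (i + 1)) (p (i + 2)) => a b c.
by elim/ord3P: a; elim/ord3P: b; elim/ord3P: c => // _ _ _;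
  first [left; split; exact: val_inj | right; split; exact: val_inj].
Qed.

(** * The Galois action on the three zeros *)

Section RootClass.
Variables (k K : fieldType) (iota : {rmorphism k -> K}).
Hypothesis Ksep : separable_closure iota.
Local Notation gal := (gal iota).
Implicit Types (x : tens332 k) (r : 'I_3 -> 'cV[K]_2).

Lemma map_wedge22 (s : {rmorphism K -> K}) (v w : 'cV[K]_2) :
  wedge [:: map_mx s v; map_mx s w] = s (wedge [:: v; w]).
Proof. by rewrite !wedge22E !mxE rmorphB !rmorphM. Qed.

Lemma binary_cubic_gal (c : nat -> k) (s : gal) (v : 'cV[K]_2) :
  binary_cubic (fun n => iota (c n)) (map_mx s v) =
  s (binary_cubic (fun n => iota (c n)) v).
Proof.
rewrite /binary_cubic !mxE -{1}(gal_fix s) -{1}(gal_fix s (c 1%N)).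
rewrite -{1}(gal_fix s (c 2%N)) -{1}(gal_fix s (c 3%N)).
by rewrite !(rmorphD, rmorphM, rmorphXn).
Qed.

Lemma cubic_form_gal x (s : gal) v :
  cubic_form (map_tens iota x) (map_mx s v) = s (cubic_form (map_tens iota x) v).
Proof. by rewrite !cubic_form_mapE binary_cubic_gal. Qed.

Lemma gal_same_point (s : gal) (v w : 'cV[K]_2) : v != 0 -> w != 0 ->
  same_point (map_mx s v) (map_mx s w) -> same_point v w.
Proof.
move=> v0 w0; have m0 (u : 'cV[K]_2) : u != 0 -> map_mx s u != 0.
  by rewrite map_mx_eq0.
rewrite !same_point_wedge ?m0 // map_wedge22 => /eqP.
by rewrite fmorph_eq0 => /eqP.
Qed.

Definition acts_by (phi : gal -> 'S_3) r :=
  forall (s : gal) i, same_point (map_mx s (r i)) (r (phi s i)).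

Lemma root_enum_acts x r : root_enum iota x r -> exists phi, acts_by phi r.
Proof.
move=> [r0 rinj rF].
have /choice [phi phiP] : forall s : gal, exists p : 'S_3,
    forall i, same_point (map_mx s (r i)) (r (p i)).
  move=> s; have /choice [f fP] : forall i, exists j, same_point (map_mx s (r i)) (r j).
    move=> i; apply/rF; first by rewrite map_mx_eq0.
    have -> : cubic_form (map_tens iota x) (map_mx s (r i)) = 0 by
      rewrite cubic_form_gal (_ : cubic_form _ _ = 0) ?rmorph0 //;
      apply/rF => //; exists i; apply: same_point_refl.
    by [].
  have finj : injective f.
    move=> i j e; apply: rinj; apply: (gal_same_point (s := s)) => //.
    by apply: same_point_trans (fP i) _; rewrite e; apply: same_point_sym.
  by exists (perm finj) => i; rewrite permE.
by exists phi.
Qed.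

Lemma acts_by_gal_hom x r phi : root_enum iota x r -> acts_by phi r -> gal_hom phi.
Proof.
move=> [r0 rinj rF] phiP; split=> [s t i|].
  apply: rinj; apply: same_point_trans (same_point_sym (phiP _ _)) _.
  have -> : map_mx (gal_comp s t) (r i) = map_mx s (map_mx t (r i)).
    by apply/matrixP => a b; rewrite !mxE.
  by apply: same_point_trans (same_point_map _ (phiP _ _)) (phiP _ _).
(* Fixing the coordinates of the normalised zeros fixes each zero, which gives continuity. *)
exists [seq normalize (r p.1) p.2 0 | p : 'I_3 * 'I_2] => s sX.
apply/permP => i; rewrite perm1; apply: rinj.
apply: same_point_trans (same_point_sym (phiP s i)) _.
have e : map_mx s (normalize (r i)) = normalize (r i).
  apply/matrixP => a b; rewrite mxE ord1 sX //.
  by apply/fintype.imageP; exists (i, a).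
apply: same_point_trans _ (normalize_same (r0 i)); rewrite -e map_normalize.
by apply: same_point_sym; apply: normalize_same; rewrite map_mx_eq0.
Qed.

Lemma root_class_conj x r phi : root_enum iota x r -> acts_by phi r ->
  root_class iota x = conj_class phi.
Proof.
move=> [r0 rinj rF] phiP; apply/seteqP; split=> [psi [r' [r'0 r'inj r'F] psiP]|psi [g psiE]].
  have /choice [f fP] : forall i, exists j, same_point (r' i) (r j).
    move=> i; apply/rF => //; apply/r'F => //; exists i; exact: same_point_refl.
  have finj : injective f.
    move=> i j e; apply: r'inj; apply: same_point_trans (fP i) _.
    by rewrite e; apply: same_point_sym.
  (* The inverse appears because products of permutations, and hence conjugation, compose from left
     to right. *)
  exists (perm finj)^-1%g => s; apply/permP => i.
  rewrite conjgE invgK !permM; apply: (@perm_inj _ (perm finj)).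
  rewrite permKV !permE; apply: rinj.
  apply: same_point_trans (same_point_sym (fP _)) _.
  apply: same_point_trans (same_point_sym (psiP s i)) _.
  by apply: same_point_trans (same_point_map _ (fP i)) (phiP _ _).
exists (fun i => r (g^-1%g i)); first split=> [//|i j /rinj /perm_inj //|v v0].
  rewrite rF //; split=> [[i vi]|[i vi]]; last by exists (g^-1%g i).
  by exists (g i); rewrite permK.
move=> s i; rewrite psiE conjgE !permM permK; exact: phiP.
Qed.

Lemma act_root_enum (g1 g2 : 'M[k]_3) (g3 : 'M[k]_2) x r :
  g1 \in unitmx -> g2 \in unitmx -> g3 \in unitmx ->
  root_enum iota (act_tens g1 g2 g3 x) r ->
  root_enum iota x (fun i => map_mx iota g3^T *m r i).
Proof.
move=> g1U g2U g3U [r0 rinj rF]; set h := map_mx iota g3^T.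
have hU : h \in unitmx by rewrite map_unitmx unitmx_tr.
have h0 v : v != 0 -> h *m v != 0.
  by apply: contra_neq => hv; rewrite -(mulKmx hU v) hv mulmx0.
have FE v : cubic_form (map_tens iota (act_tens g1 g2 g3 x)) v = 0 <->
    cubic_form (map_tens iota x) (h *m v) = 0.
  rewrite map_act_tens cubic_form_act matrix.map_trmx -/h.
  have d0 (g : 'M[k]_3) : g \in unitmx -> \det (map_mx iota g) != 0.
    by move=> gU; rewrite -unitfE -unitmxE map_unitmx.
  split=> [/eqP|->]; last by rewrite mulr0.
  by rewrite !mulf_eq0 !(negPf (d0 _ _)) //= => /eqP.
split=> [i|i j hij|v v0]; first exact: h0.
  apply: rinj; rewrite -(mulKmx hU (r i)) -(mulKmx hU (r j)).
  exact: same_point_mulmx.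
have vE : v = h *m (invmx h *m v) by rewrite mulKVmx.
rewrite {1}vE -FE rF; last by apply: contra_neq v0 => e; rewrite vE e mulmx0.
split=> [[i vi]|[i vi]]; exists i; first by rewrite vE; apply: same_point_mulmx.
by rewrite -(mulKmx hU (r i)); apply: same_point_mulmx.
Qed.

Lemma root_class_act (g1 g2 : 'M[k]_3) (g3 : 'M[k]_2) x phi :
  g1 \in unitmx -> g2 \in unitmx -> g3 \in unitmx ->
  root_class iota (act_tens g1 g2 g3 x) phi -> root_class iota x phi.
Proof.
move=> g1U g2U g3U [r renum phiP]; have := act_root_enum g1U g2U g3U renum.
exists (fun i => map_mx iota g3^T *m r i) => // s i.
rewrite map_mxM /= (_ : map_mx s (map_mx iota _) = map_mx iota g3^T); last first.
  by apply/matrixP => a b; rewrite !mxE gal_fix.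
exact: same_point_mulmx.
Qed.

Lemma root_class_orbit x y : orbit_tens x y -> root_class iota y = root_class iota x.
Proof.
move=> [g1 [g2 [g3 [g1U g2U g3U ->]]]]; apply/seteqP; split=> phi.
  exact: root_class_act.
move=> px; apply: (@root_class_act (invmx g1) (invmx g2) (invmx g3));
  by rewrite ?unitmx_inv // act_tensM !mulVmx // act_tens1.
Qed.

End RootClass.

Section CubicOrbits.
Variable k : fieldType.
Implicit Types (x : tens332 k).

(** No [x_1] appears here, but the reduction needs one: an auxiliary [y] with non-zero P_2 is added
    and then forgotten. *)
Lemma orbit_tens_normal_form x : P1 x != 0 ->
  orbit_tens x = orbit_tens (normal_form (cubic_coef x)).
Proof.
move=> /exists_p2_neq0 [y py]; have := orbit_normal_form py => /= e.
have : orbit_space (y, x) (basis k 0, normal_form (cubic_coef x)).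
  by rewrite e; apply: orbit_space_self.
move=> [g1 [g2 [g3 [t [g1U g2U g3U _ [_ ->]]]]]].
by rewrite orbit_tens_act.
Qed.

Lemma orbit_tens_cubic x x' (g : 'M[k]_2) a : P1 x != 0 -> P1 x' != 0 ->
  g \in unitmx -> a != 0 ->
  (forall n, (n < 4)%N -> cubic_coef x' n = a * cubic_subst g (cubic_coef x) n) ->
  orbit_tens x = orbit_tens x'.
Proof.
move=> px px' gU a0 e.
rewrite -(orbit_tens_act x (unitmx1 _ _) (unitmx1 _ _) gU).
rewrite (orbit_tens_normal_form px') orbit_tens_normal_form; last first.
  have d1 : (\det (1%:M : 'M[k]_3) * \det (1%:M : 'M[k]_3)) ^+ 4 != 0.
    by rewrite !det1 mulr1 expr1n oner_neq0.
  have d2 : \det g ^+ 6 != 0 by rewrite expf_neq0 // -unitfE -unitmxE.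
  by rewrite P1_act; apply: mulf_neq0 (mulf_neq0 d1 d2) px.
have [h1 [h2 [t [h1U h2U _ [_ e']]]]] :=
  scale_normal_form (cubic_coef (act_tens 1%:M 1%:M g x)) a0.
have cE n : (n < 4)%N ->
    cubic_coef x' n = a * cubic_coef (act_tens 1%:M 1%:M g x) n.
  by move=> ltn; rewrite (e n ltn) (cubic_coef_act _ _ _ _ ltn) !(det1 k 3) mulr1 mul1r.
rewrite [in RHS](eq_normal_form cE).
by rewrite e' orbit_tens_act ?unitmx1.
Qed.

End CubicOrbits.

(** * Semistable orbits and classes of homomorphisms *)

Section RootClassBijection.
Variables (k K : fieldType) (iota : {rmorphism k -> K}).
Hypothesis Ksep : separable_closure iota.
Local Notation gal := (gal iota).
Implicit Types (x : tens332 k) (r : 'I_3 -> 'cV[K]_2).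

Lemma normalize_enum x r (phi : gal -> 'S_3) : root_enum iota x r -> acts_by phi r ->
  let R i := normalize (r i) in
  [/\ forall (s : gal) i, map_mx s (R i) = R (phi s i),
      forall i j, i != j -> wedge [:: R i; R j] != 0 &
      forall i, binary_cubic (fun n => iota (cubic_coef x n)) (R i) = 0].
Proof.
move=> [r0 rinj rF] phiP R.
have R0 i : R i != 0 by rewrite (same_point_neq0 (normalize_same (r0 i))).
split=> [s i|i j|i].
- by rewrite map_normalize; apply: normalize_eq.
- move=> ne; apply/eqP => /(same_point_wedge (R0 i) (R0 j)) Rij; case/eqP: ne; apply: rinj.
  apply: same_point_trans (same_point_sym (normalize_same (r0 i))) _.
  exact: same_point_trans Rij (normalize_same (r0 j)).
- rewrite -cubic_form_mapE; apply/rF => //; exists i; exact: normalize_same.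
Qed.

Lemma descend_matrix (h : 'M[K]_2) : (forall s : gal, map_mx s h = h) ->
  exists g, h = map_mx iota g.
Proof.
move=> sh; have /choice [f fP] : forall p : 'I_2 * 'I_2, exists a, h p.1 p.2 = iota a.
  move=> [i j]; apply: (gal_fixed Ksep) => s /=.
  by rewrite -{2}(sh s) mxE.
exists (\matrix_(i, j) f (i, j)); apply/matrixP => i j.
by rewrite !mxE -fP.
Qed.

(** Three vectors of a plane satisfy one linear relation, with the opposite brackets as
    coefficients. Hence a single linear map [h] sends each [be i *: R' i] to [al i *: R i]. An odd
    permutation changes the sign of both [al] and [be], so the quotients [ep] are permuted exactly
    and [h] itself is Galois-invariant. *)
Lemma descend_projectivity (R R' : 'I_3 -> 'cV[K]_2) (phi : gal -> 'S_3) :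
  (forall i j, i != j -> wedge [:: R i; R j] != 0) ->
  (forall i j, i != j -> wedge [:: R' i; R' j] != 0) ->
  (forall (s : gal) i, map_mx s (R i) = R (phi s i)) ->
  (forall (s : gal) i, map_mx s (R' i) = R' (phi s i)) ->
  exists2 g : 'M[k]_2, g \in unitmx &
    forall i, exists b, map_mx iota g^T *m R' i = b *: R i.
Proof.
move=> Rw R'w sR sR'.
pose al i := wedge [:: R (i + 1); R (i + 2)].
pose be i := wedge [:: R' (i + 1); R' (i + 2)].
have ne12 (i : 'I_3) : i + 1 != i + 2 by elim/ord3P: i.
have al0 i : al i != 0 by apply: Rw.
have be0 i : be i != 0 by apply: R'w.
pose ep i := al i / be i.
have sep (s : gal) i : s (ep i) = ep (phi s i).
  rewrite /ep fmorph_div /al /be -!map_wedge22 !sR !sR'.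
  have [[-> ->]|[-> ->]] := perm3_cases (phi s) i => //.
  rewrite (_ : wedge [:: R (phi s i + 2); R (phi s i + 1)] = - al (phi s i)); last by rewrite /al !wedge22E; ring.
  rewrite (_ : wedge [:: R' (phi s i + 2); R' (phi s i + 1)] = - be (phi s i)); last by rewrite /be !wedge22E; ring.
  by rewrite invrN mulrNN.
pose M (u v : 'cV[K]_2) : 'M[K]_2 := \matrix_(i, j) (if j == 0 then u else v) i 0.
have M0 u v : M u v *m basis K 0 = u by rewrite /basis -colE; apply/colP => i; rewrite !mxE.
have M1 u v : M u v *m basis K 1 = v by rewrite /basis -colE; apply/colP => i; rewrite !mxE.
have detM u v : \det (M u v) = wedge [:: u; v] by rewrite det2E wedge22E !mxE /=; ring.
have MU u v : wedge [:: u; v] != 0 -> M u v \in unitmx by rewrite unitmxE unitfE detM.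
have B'U := MU _ _ (R'w 0 1 isT); set B' := M _ _ in B'U.
pose h := M (ep 0 *: R 0) (ep 1 *: R 1) *m invmx B'.
have h0 : h *m R' 0 = ep 0 *: R 0 by rewrite -(M0 (R' 0) (R' 1)) -/B' /h mulmxA mulmxKV // M0.
have h1 : h *m R' 1 = ep 1 *: R 1 by rewrite -{1}(M1 (R' 0) (R' 1)) -/B' /h mulmxA mulmxKV // M1.
have rel (Q : 'I_3 -> 'cV[K]_2) : wedge [:: Q 1; Q 2] *: Q 0 + wedge [:: Q 2; Q 0] *: Q 1
    + wedge [:: Q 0; Q 1] *: Q 2 = 0.
  by apply/colP; elim/ord2P; rewrite !wedge22E !mxE; ring.
have alE : [/\ al 0 = wedge [:: R 1; R 2], al 1 = wedge [:: R 2; R 0] & al 2 = wedge [:: R 0; R 1]].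
  by rewrite /al !add0r !ord3_eqs.
have beE : [/\ be 0 = wedge [:: R' 1; R' 2], be 1 = wedge [:: R' 2; R' 0] & be 2 = wedge [:: R' 0; R' 1]].
  by rewrite /be !add0r !ord3_eqs.
have epE i : be i * ep i = al i by rewrite /ep mulrC divfK.
have h2 : h *m R' 2 = ep 2 *: R 2.
  have [a0 a1 a2] := alE; have [b0 b1 b2] := beE.
  apply: (scalerI (be0 2)); rewrite scalerA epE.
  apply: (addrI (al 0 *: R 0 + al 1 *: R 1)).
  have := rel R; rewrite -a0 -a1 -a2 => ->.
  have := congr1 (mulmx h) (rel R'); rewrite -b0 -b1 -b2 mulmx0 !mulmxDr -!scalemxAr h0 h1.
  by rewrite !scalerA !epE => ->.
have hE i : h *m R' i = ep i *: R i by elim/ord3P: i.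
have B'inj (h' : 'M[K]_2) : (forall i, h' *m R' i = h *m R' i) -> h' = h.
  move=> e; rewrite -(mulmxK B'U h') -(mulmxK B'U h); congr (_ *m _).
  have E (N : 'M[K]_2) : N *m B' = M (N *m R' 0) (N *m R' 1).
    by apply/matrixP => i; elim/ord2P; rewrite !mxE; apply: eq_bigr => l _; rewrite !mxE.
  by rewrite !E !e.
have [s|g hg] := descend_matrix (h := h).
  apply: B'inj => i; have [j ->] : exists j, i = phi s j.
    by exists ((phi s)^-1%g i); rewrite permKV.
  by rewrite -sR' -map_mxM hE map_mxZ sR sep -hE sR'.
exists g^T; last by rewrite trmxK -hg => i; exists (ep i).
have ep_neq0 i : ep i != 0 by rewrite mulf_neq0 ?invr_eq0.
have : h \in unitmx.
  rewrite unitmx_mul unitmx_inv B'U andbT; apply: MU.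
  rewrite (_ : wedge _ = ep 0 * ep 1 * wedge [:: R 0; R 1]).
    by apply: mulf_neq0; [apply: mulf_neq0 (ep_neq0 _) (ep_neq0 _)|exact: Rw].
  by rewrite !wedge22E !mxE; ring.
by rewrite hg map_unitmx unitmx_tr.
Qed.

Lemma root_class_inj x x' : P1 x != 0 -> P1 x' != 0 ->
  root_class iota x = root_class iota x' -> orbit_tens x = orbit_tens x'.
Proof.
move=> px px' e; have [r renum] := exists_root_enum Ksep px.
have [phi phiP] := root_enum_acts renum.
have : root_class iota x phi by exists r.
rewrite e => -[r' r'enum phiP'].
have [sR Rw FR] := normalize_enum renum phiP.
have [sR' R'w FR'] := normalize_enum r'enum phiP'.
have [g gU gR] := descend_projectivity Rw R'w sR sR'.
have [G GP] := cubic_three_roots R'w.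
pose c n := cubic_subst g (cubic_coef x) n; pose c' := cubic_coef x'.
have [mu muP] := GP _ FR'.
have [|nu nuP] := GP (fun n => iota (c n)).
  move=> i; have [b gb] := gR i.
  have := binary_cubicZ (fun n => iota (cubic_coef x n)) b (normalize (r i)).
  rewrite FR mulr0 -gb -matrix.map_trmx binary_cubic_subst => e0.
  by rewrite -[RHS]e0 /binary_cubic /c !map_cubic_subst.
have disc0 (d : nat -> k) m : cubic_disc d != 0 ->
    (forall n, (n < 4)%N -> iota (d n) = m * G n) -> m != 0.
  move=> d0 dm; apply: contra_neq d0 => m0; apply/eqP.
  rewrite -(fmorph_eq0 iota) -cubic_disc_map (eq_cubic_disc dm) m0 cubic_disc_scale.
  by rewrite expr0n mul0r.
have mu0 := disc0 _ _ px' muP.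
have dc : cubic_disc c != 0.
  have dg : \det g != 0 by rewrite -unitfE -unitmxE.
  by rewrite cubic_disc_subst; apply: mulf_neq0 (expf_neq0 6 dg) px.
have nu0 := disc0 _ _ dc nuP.
(* The forms [c] and [c'] are proportional over K; comparing one non-zero coefficient shows that the
   ratio lies in k. *)
have [m [ltm cm0]] : exists m, (m < 4)%N /\ c m != 0.
  apply: contrapT => none; case/eqP: dc.
  have c0 n : (n < 4)%N -> c n = 0.
    by move=> ltn; apply/eqP/negPn/negP => cn; apply: none; exists n.
  by rewrite /cubic_disc !c0 //; ring.
have aE : iota (c' m / c m) = mu / nu.
  rewrite fmorph_div muP // nuP //.
  have Gm0 : G m != 0 by apply: contra_neq cm0 => G0; apply/eqP; rewrite -(fmorph_eq0 iota) nuP // G0 mulr0.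
  by rewrite -mulf_div divff // mulr1.
apply: (orbit_tens_cubic px px' gU (a := c' m / c m)).
  by rewrite -(fmorph_eq0 iota) aE mulf_neq0 ?invr_eq0.
move=> n ltn; apply: (fmorph_inj iota).
by rewrite rmorphM aE muP // -/(c n) nuP // mulrA divfK.
Qed.

(* The coefficients of the product of the linear forms [v |-> wedge [:: v; r i]]. *)
Definition cubic_of_roots r (n : nat) : K :=
  let p i := r i 0 0 in let q i := r i 1 0 in
  match n with
  | 0 => q 0 * q 1 * q 2
  | 1 => - (p 0 * q 1 * q 2 + q 0 * p 1 * q 2 + q 0 * q 1 * p 2)
  | 2 => p 0 * p 1 * q 2 + p 0 * q 1 * p 2 + q 0 * p 1 * p 2
  | _ => - (p 0 * p 1 * p 2)
  end.

Lemma cubic_of_rootsE r v : binary_cubic (cubic_of_roots r) v =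
  wedge [:: v; r 0] * wedge [:: v; r 1] * wedge [:: v; r 2].
Proof. by rewrite /binary_cubic !wedge22E /=; ring. Qed.

Lemma cubic_of_roots_disc r : cubic_disc (cubic_of_roots r) =
  (wedge [:: r 0; r 1] * wedge [:: r 1; r 2] * wedge [:: r 0; r 2]) ^+ 2.
Proof. by rewrite /cubic_disc !wedge22E /=; ring. Qed.

Lemma cubic_of_roots_perm r (p : 'S_3) n :
  cubic_of_roots (r \o p) n = cubic_of_roots r n.
Proof.
have := perm3_cases p 0; rewrite !add0r /cubic_of_roots /=.
by move: (p 0) (p 1) (p 2) => a b c [[-> ->]|[-> ->]];
  elim/ord3P: a; rewrite ?add0r ?ord3_eqs; case: n => [|[|[|n]]]; ring.
Qed.

Lemma map_cubic_of_roots (s : {rmorphism K -> K}) r n :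
  cubic_of_roots (fun i => map_mx s (r i)) n = s (cubic_of_roots r n).
Proof.
by case: n => [|[|[|n]]]; rewrite /cubic_of_roots !mxE ?rmorphN ?rmorphD !rmorphM.
Qed.

(** The three difference vectors sum to 0, so their pairwise brackets agree up to sign, each being
    plus or minus [\sum_i d l i * m i]. One non-vanishing condition thus separates all three points.
    Galois permutes the vectors up to the sign of the permutation, which is harmless in P^1. *)
Lemma exists_acts_by (phi : gal -> 'S_3) : gal_hom phi -> exists r,
  [/\ forall i, r i != 0, forall i j, same_point (r i) (r j) -> i = j & acts_by phi r].
Proof.
move=> phiP; have span := equivariant_span Ksep phiP.
have [l [leq l01]] : exists l, equivariant phi l /\ l 0 != l 1.
  apply: contrapT => none.
  suff /eqP : (1 : K) = 0 by rewrite oner_eq0.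
  (* The functional [l 0 - l 1] is not zero, so it cannot kill all equivariant vectors. The
     resulting [l] has [d l 2 != 0], whence the existence of [m]. *)
  apply: (span (fun i : 'I_3 => if i == 0 then 1 else if i == 1 then -1 else 0) _ 0).
  move=> l leq; rewrite sum3E /= mul0r addr0 mul1r mulN1r.
  apply/eqP; rewrite subr_eq0; apply/negPn/negP => l01.
  by apply: none; exists l.
pose d (f : 'I_3 -> K) i := f (i + 1) - f (i + 2).
have [m [meq dm]] : exists m, equivariant phi m /\ \sum_i d l i * m i != 0.
  apply: contrapT => none; have d2 : d l 2 = 0.
    apply: (span (d l)) => m meq; apply/eqP/negPn/negP => dm.
    by apply: none; exists m.
  by move: d2 l01; rewrite /d !ord3_eqs => /eqP; rewrite subr_eq0 => ->.
pose r i : 'cV[K]_2 := \col_j (if j == 0 then d l i else d m i).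
have rw i j : i != j -> wedge [:: r i; r j] != 0.
  move=> ne; move: dm; apply: contra_neq; rewrite wedge22E !mxE /= sum3E /d => e.
  move: e ne; elim/ord3P: i; elim/ord3P: j; rewrite ?add0r ?ord3_eqs => // e _;
    first [by rewrite -[RHS]e; ring | by rewrite -[RHS]oppr0 -e; ring].
have r0 i : r i != 0.
  have : i != i + 1 by elim/ord3P: i.
  move=> /rw; apply: contra_neq => e; rewrite e wedge22E !mxE; ring.
exists r; split=> // [i j rij|s i].
  apply/eqP/negPn/negP => /rw /eqP; apply.
  exact/(same_point_wedge (r0 i) (r0 j)).
have sd f : equivariant phi f -> s (d f i) = f (phi s (i + 1)) - f (phi s (i + 2)).
  by move=> feq; rewrite /d rmorphB !feq.
have [[e1 e2]|[e1 e2]] := perm3_cases (phi s) i.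
  exists 1; rewrite ?oner_neq0 // scale1r; apply/colP; elim/ord2P; rewrite !mxE /= sd ?e1 ?e2 //.
exists (- 1); rewrite ?oppr_eq0 ?oner_neq0 // scaleN1r.
by apply/colP; elim/ord2P; rewrite !mxE /= sd ?e1 ?e2 // /d opprB.
Qed.

(** Galois permutes the normalised zeros exactly and the coefficients of the product of linear forms
    are symmetric in them, so these lie in k; the normal form realises any four coefficients. *)
Lemma exists_tensor (phi : gal -> 'S_3) : gal_hom phi ->
  exists2 x, P1 x != 0 & root_class iota x = conj_class phi.
Proof.
move=> /exists_acts_by [r [r0 rinj phir]].
pose R i := normalize (r i).
have RE i : same_point (R i) (r i) by apply: normalize_same.
have R0 i : R i != 0 by rewrite (same_point_neq0 (RE i)).
have Rinj i j : same_point (R i) (R j) -> i = j.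
  move=> Rij; apply: rinj; apply: same_point_trans (same_point_sym (RE i)) _.
  exact: same_point_trans Rij (RE j).
have sR (s : gal) i : map_mx s (R i) = R (phi s i).
  by rewrite map_normalize; apply: normalize_eq; apply: phir.
have Rw i j : i != j -> wedge [:: R i; R j] != 0.
  move=> ne; apply/eqP => /(same_point_wedge (R0 i) (R0 j)) /Rinj e.
  by rewrite e eqxx in ne.
have /choice [c cP] : forall n, exists a, cubic_of_roots R n = iota a.
  move=> n; apply: (gal_fixed Ksep) => s; rewrite -map_cubic_of_roots.
  rewrite -[RHS](cubic_of_roots_perm R (phi s)).
  by rewrite /cubic_of_roots /= !sR.
have cE n : (n < 4)%N -> iota (cubic_coef (normal_form c) n) = cubic_of_roots R n.
  by move=> ltn; rewrite cubic_coef_normal_form // cP.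
have FE v : cubic_form (map_tens iota (normal_form c)) v =
    wedge [:: v; R 0] * wedge [:: v; R 1] * wedge [:: v; R 2].
  by rewrite cubic_form_mapE -cubic_of_rootsE /binary_cubic !cE.
exists (normal_form c).
  rewrite -(fmorph_eq0 iota) P1E -cubic_disc_map (eq_cubic_disc cE) cubic_of_roots_disc.
  by rewrite expf_neq0 // mulf_neq0 ?Rw // mulf_neq0 ?Rw.
apply: (@root_class_conj _ _ _ _ R); last by move=> s i; rewrite sR; apply: same_point_refl.
split=> // v v0; rewrite FE; split=> [/eqP|[i /(same_point_wedge v0 (R0 i))]].
  rewrite !mulf_eq0 -orbA => /or3P [] /eqP /(same_point_wedge v0 (R0 _));
    [exists 0 | exists 1 | exists 2]; by [].
by elim/ord3P: i => ->; ring.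
Qed.

Theorem root_class_bijection :
  induces_bij (ss332 k) (@orbit_tens k) (Ex3 iota) (root_class iota).
Proof.
exists (fun O => [set phi | exists2 x, O x & root_class iota x phi]).
  move=> x _; apply/seteqP; split=> [phi [y xy]|phi px].
    by rewrite (root_class_orbit iota xy).
  by exists x => //; apply: orbit_tens_self.
have fE x : [set phi | exists2 y, orbit_tens x y & root_class iota y phi] = root_class iota x.
  apply/seteqP; split=> [phi [y xy]|phi px].
    by rewrite (root_class_orbit iota xy).
  by exists x => //; apply: orbit_tens_self.
split.
- move=> _ [x px <-]; rewrite fE; have [r renum] := exists_root_enum Ksep px.
  have [phi phiP] := root_enum_acts renum.
  by exists phi; [exact: acts_by_gal_hom renum phiP | rewrite (root_class_conj renum phiP)].
- move=> _ _ /set_mem [x px <-] /set_mem [x' px' <-]; rewrite !fE; exact: root_class_inj px px'.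
move=> _ [phi phiP <-]; have [x px e] := exists_tensor phiP.
by exists (orbit_tens x); [exists x | rewrite fE].
Qed.

End RootClassBijection.

Theorem proposition7p5 (k : fieldType) :
  exists2 P2 : zpoly, is_P2 P2 &
    induces_bij (U P2) (@orbit_space k)
      (@orbit_tens k @` ss332 k) (fun x => orbit_tens x.2)
    /\
    (forall (K : fieldType) (iota : {rmorphism k -> K}),
      separable_closure iota ->
      induces_bij (ss332 k) (@orbit_tens k) (Ex3 iota) (root_class iota)).
Proof.
exists P2_poly; first exact: P2_polyP.
by split=> [|K iota Ksep]; [exact: orbit_space_bijection | exact: root_class_bijection].
Qed.
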